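(* Let $W$ be a finite Coxeter (real reflection) group, let $0<\theta\le1$, $q=\theta^{-1}$, and let $H$ be the Iwahori-Hecke algebra of $W$ with parameter $q$. Let $w_0$ be the longest element of $W$ and let $K$ be the systematic scan Metropolis chain on $W$, i.e. the reversible Markov chain on $W$ with stationary distribution $\pi$ determined by left multiplication by the element $\tilde T_{w_0}^2$ of $H$. Then, for every number of steps $\ell$, (a) $\displaystyle \Vert K_1^\ell/\pi-1\Vert_2^2=\sum_{\lambda\ne\mathbf 1}t_\lambda d_\lambda\,\theta^{2\ell(\ell(w_0)-c_\lambda)}$, (b) $\displaystyle \sum_{x\in W}\pi(x)\Vert K_x^\ell/\pi-1\Vert_2^2=\sum_{\lambda\ne\mathbf 1}d_\lambda^2\,\theta^{2\ell(\ell(w_0)-c_\lambda)}$, where the sums are over all $\lambda\in\hat W$ different from the index $\mathbf 1$ of the trivial representation.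
   Context: $W$ has simple reflections $s_1,\dots,s_n$ and length function $w\mapsto\ell(w)$; the symbol $\ell$ without argument denotes a number of steps. $P_W(q)=\sum_{w\in W}q^{\ell(w)}$ and $\pi(w)=q^{\ell(w)}/P_W(q)$. $H$ is the complex algebra with basis $\{T_w\mid w\in W\}$ and multiplication $T_{s_i}T_w=T_{s_iw}$ if $\ell(s_iw)=\ell(w)+1$, $T_{s_i}T_w=(q-1)T_w+qT_{s_iw}$ if $\ell(s_iw)=\ell(w)-1$. Put $\tilde T_w=q^{-\ell(w)}T_w$. A Markov chain $K$ on $W$ is determined by left multiplication by $h\in H$ if $h\tilde T_x=\sum_{y\in W}K(x,y)\tilde T_y$ for all $x\in W$. For $x\in W$, $K_x^\ell$ is the function $y\mapsto K^\ell(x,y)$ (and $K_1^\ell$ is the case $x=1$, the identity); $K_x^\ell/\pi-1$ is the function $y\mapsto K^\ell(x,y)/\pi(y)-1$; and $\Vert f\Vert_2^2=\sum_{x\in W}f(x)^2\pi(x)$. $\hat W$ indexes the irreducible complex representations of $W$, with characters $\chi_W^\lambda$; the irreducible representations of $H$ are indexed by the same set so that the character $\chi_H^\lambda$ satisfies $\chi^\lambda_H(T_w)|_{q=1}=\chi_W^\lambda(w)$ for all $w\in W$. The index $\mathbf 1$ is that of the trivial representation, $\chi_H^{\mathbf 1}(T_w)=q^{\ell(w)}$. $d_\lambda=\chi_W^\lambda(1)$ is the dimension. The generic degrees $t_\lambda$ are defined by $\vec t=\sum_{\lambda\in\hat W}t_\lambda\chi_H^\lambda$, where $\vec t:H\to\mathbb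 C$ is the trace with $\vec t(T_1)=P_W(q)$ and $\vec t(T_w)=0$ for $w\ne1$. Finally $c_\lambda=\chi_W^\lambda(z)/d_\lambda$, where $z$ is the sum of all reflections in $W$ (in the group algebra of $W$). *)

(* Defs.v *)
From HB Require Import structures.
From mathcomp Require Import all_boot all_order all_algebra all_fingroup.
From mathcomp Require Import all_field all_character complex.
From mathcomp Require Import all_classical all_reals all_analysis.

Set Implicit Arguments.
Unset Strict Implicit.
Unset Printing Implicit Defensive.

Import Order.TTheory GRing.Theory Num.Theory.
Import numFieldNormedType.Exports.

Local Open Scope complex_scope.
Local Open Scope ring_scope.

(** * Finite Coxeter systems *)

(* The second field is the universal property of the presentation with
   generators S and relations (s t)^m(s,t) = 1, where m(s,t) is the order of
   s t in W; the target G ranges over all groups, finite or not. *)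
Record coxeter_system (W : finGroupType) (S : {set W}) : Prop := {
  coxeter_gen : <<S>>%g = [set: W]%SET;
  coxeter_order2 : forall s, s \in S -> #[s]%g = 2%N;
  coxeter_pres : forall (G : groupType) (f : W -> G),
    (forall s t, s \in S -> t \in S -> ((f s * f t) ^+ #[s * t]%g)%g = 1%g) ->
    exists phi : {multiplicative W -> G}, forall s, s \in S -> phi s = f s }.

(* (S ^+ k)%g is the set of all products of k elements of S.  Since S generates
   W, every element is such a product with k < #|W|. *)
Definition coxeter_length (W : finGroupType) (S : {set W}) (w : W) : nat :=
  \big[minn/#|W|]_(k < #|W| | w \in (S ^+ k)%g) k.

Definition is_longest (W : finGroupType) (S : {set W}) (w0 : W) : Prop :=
  forall w, (coxeter_length S w <= coxeter_length S w0)%N.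

Definition reflections (W : finGroupType) (S : {set W}) : {set W} :=
  class_support S [set: W]%SET.

Definition poincare (R : realType) (W : finGroupType) (S : {set W}) (q : R) : R :=
  \sum_(w : W) q ^+ coxeter_length S w.

Definition pi_dist (R : realType) (W : finGroupType) (S : {set W}) (q : R)
    (w : W) : R :=
  q ^+ coxeter_length S w / poincare S q.

(** * Irreducible complex representations of W *)

Definition Irr (R : realType) (W : finGroupType) : irrType R[i] [set: W]%SET :=
  DecSocleType (regular_repr R[i] [set: W]%SET).

Definition charW (R : realType) (W : finGroupType) (lam : Irr R W) (w : W) : R[i] :=
  \tr (irr_repr lam w).

Definition dimW (R : realType) (W : finGroupType) (lam : Irr R W) : nat :=
  irr_degree lam.

(* gset_mx is the sum of the reflections in the group algebra, and gring_op
   extends a representation of W to the group algebra.  The quotient of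
   complex numbers is real, because reflections are involutions. *)
Definition refl_content (R : realType) (W : finGroupType) (S : {set W})
    (lam : Irr R W) : R :=
  complex.Re
    (\tr (gring_op (irr_repr lam) (gset_mx R[i] [set: W]%SET (reflections S)))
     / (dimW lam)%:R).

(** * Matrix representations of a finite-dimensional algebra *)

(* The matrices act on row vectors on the right, as in mxrepresentation, and
   irreducibility and similarity are rendered as in mx_irreducible and
   mx_rsim. *)
Definition alg_repr (F : fieldType) (A : falgType F) (n : nat)
    (rho : A -> 'M[F]_n) : Prop :=
  [/\ linear rho, rho 1 = 1%:M & forall a b, rho (a * b) = rho a *m rho b].

Definition alg_irreducible (F : fieldType) (A : falgType F) (n : nat)
    (rho : A -> 'M[F]_n) : Prop :=
  [/\ alg_repr rho, (0 < n)%N &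
      forall U : 'M[F]_n,
        (forall a, stablemx U (rho a)) -> U != 0 -> row_full U].

Definition alg_rsim (F : fieldType) (A : falgType F) (n1 n2 : nat)
    (rho1 : A -> 'M[F]_n1) (rho2 : A -> 'M[F]_n2) : Prop :=
  exists B : 'M[F]_(n1, n2),
    [/\ n2 = n1, row_free B & forall a, rho1 a *m B = B *m rho2 a].

(* rho lists the irreducible representations of A, each isomorphism class
   exactly once. *)
Record indexes_irreps (F : fieldType) (A : falgType F) (I : Type)
    (n : I -> nat) (rho : forall i, A -> 'M[F]_(n i)) : Prop := {
  indexes_irr : forall i, alg_irreducible (rho i);
  indexes_inj : forall i j, alg_rsim (rho i) (rho j) -> i = j;
  indexes_surj : forall m (sigma : A -> 'M[F]_m),
    alg_irreducible sigma -> exists i, alg_rsim sigma (rho i) }.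

(** * Iwahori-Hecke algebras *)

Record hecke_algebra (R : realType) (W : finGroupType) (S : {set W}) (q : R) := {
  hecke_sort :> falgType R[i];
  hecke_T : W -> hecke_sort;
  hecke_basis : basis_of fullv (codom hecke_T);
  hecke_mul_up : forall s w, s \in S ->
    coxeter_length S (s * w)%g = (coxeter_length S w).+1 ->
    hecke_T s * hecke_T w = hecke_T (s * w)%g;
  hecke_mul_down : forall s w, s \in S ->
    (coxeter_length S (s * w)%g).+1 = coxeter_length S w ->
    hecke_T s * hecke_T w
      = (q - 1)%:C *: hecke_T w + q%:C *: hecke_T (s * w)%g }.

Definition hecke_Tt (R : realType) (W : finGroupType) (S : {set W}) (q : R)
    (H : hecke_algebra S q) (w : W) : H :=
  (q ^- coxeter_length S w)%:C *: hecke_T H w.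

Definition hecke_trace (R : realType) (W : finGroupType) (S : {set W}) (q : R)
    (H : hecke_algebra S q) (h : H) : R[i] :=
  (poincare S q)%:C * coord (codom_tuple (hecke_T H)) (enum_rank 1%g) h.

(* The common indexing of the irreducible representations of W and of H q.
   For a fixed numerical q, specializing chi_H^lambda(T_w) to q = 1 only makes
   sense for a character that varies with the parameter, so the indexing is
   that of the whole family of algebras H q, q > 0, with character values
   depending continuously on q; this determines it. *)
Record hecke_deformation (R : realType) (W : finGroupType) (S : {set W})
    (H : forall q : R, hecke_algebra S q) (n : R -> Irr R W -> nat)
    (rho : forall q lam, H q -> 'M[R[i]]_(n q lam)) : Prop := {
  deformation_irr : forall q, 0 < q -> indexes_irreps (rho q);
  deformation_cont : forall lam w q, 0 < q ->
    {for q, continuous (fun r : R => \tr (rho r lam (hecke_T (H r) w)) : R[i]^o)};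
  deformation_at1 : forall lam w,
    \tr (rho 1 lam (hecke_T (H 1) w)) = charW lam w }.

Definition generic_degrees (R : realType) (W : finGroupType) (S : {set W})
    (q : R) (H : hecke_algebra S q) (n : Irr R W -> nat)
    (rho : forall lam, H -> 'M[R[i]]_(n lam)) (t : Irr R W -> R[i]) : Prop :=
  forall h : H, hecke_trace h = \sum_lam t lam * \tr (rho lam h).

(** * Markov chains on W *)

Definition markov_chain (R : realType) (W : finType) (K : W -> W -> R) : Prop :=
  (forall x y, 0 <= K x y) /\ (forall x, \sum_y K x y = 1).

Definition reversible (R : realType) (W : finType) (p : W -> R)
    (K : W -> W -> R) : Prop :=
  forall x y, p x * K x y = p y * K y x.

Definition determined_by (R : realType) (W : finGroupType) (S : {set W}) (q : R)
    (H : hecke_algebra S q) (K : W -> W -> R) (h : H) : Prop :=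
  forall x, h * hecke_Tt H x = \sum_y (K x y)%:C *: hecke_Tt H y.

Definition kernel_pow (R : realType) (W : finType) (K : W -> W -> R) (l : nat) :
    W -> W -> R :=
  iter l (fun P x y => \sum_z K x z * P z y) (fun x y => (x == y)%:R).

Definition norm2_sq (R : realType) (W : finType) (p : W -> R) (f : W -> R) : R :=
  \sum_x f x ^+ 2 * p x.

(* Main.v *)
Require Import Defs.
From HB Require Import structures.
From mathcomp Require Import all_boot all_order all_algebra all_fingroup.
From mathcomp Require Import all_field all_character complex.
From mathcomp Require Import all_classical all_reals all_analysis.
From mathcomp Require Import ring.

(** The chain is reversible, so the squared distance from stationarity after l
    steps started at x is K^(2l)(x,x) / pi(x) - 1 ([norm2_sq_kernel_pow]).  Let
    h be the square of the normalized [T_w0].  Since K is the matrix of left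
    multiplication by h, the quantity in (a) is the value of [hecke_trace] at
    h^(2l), minus 1 ([return_hecke_trace]), and the quantity in (b) is the
    trace of left multiplication by h^(2l) on the whole algebra, minus 1.

    The element [T_w0 ^+ 2] is central ([hecke_central]), so by Schur's lemma it
    acts by a scalar in each irreducible representation.  To find the scalar,
    take determinants.  [T_s] has eigenvalues q and -1, and the letters of a
    reduced word of [w0] correspond one to one to the reflections of W, so the
    determinant of [T_w0 ^+ 2] is a power of q whose exponent is twice the sum,
    over all reflections, of the multiplicities of the eigenvalue q; this sum
    is expressed by the content c ([sum_plus_mult]).  The scalar is therefore
    q^(len w0 + c) up to a root of unity.  Dimensions, multiplicities and this
    root of unity are continuous in q and take countably many values, so they
    are constant ([continuous_countable_const]) and can be computed at q = 1,
    in the representation of W ([deformation_scalar]).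

    For (a) it remains to expand [hecke_trace] into characters.  For (b), the
    trace form is nondegenerate and is a combination of the characters, so the
    representations separate the elements of H; as the squares of the
    dimensions sum to the order of W, the algebra is the product of the
    corresponding matrix algebras, and left multiplication by h^(2l) is
    diagonal with each scalar occurring d^2 times ([mxtrace_left_mul]).  In both
    sums the term of the index representation is 1: its content is the number
    of reflections, which is len w0, and its generic degree is 1
    ([generic_degree_triv]).

    The combinatorics of lengths is derived from the presentation of W through
    its action on signed reflections ([inversion_cocycle]). *)

Set Implicit Arguments.
Unset Strict Implicit.
Unset Printing Implicit Defensive.
Import Order.TTheory GRing.Theory Num.Theory.
Import numFieldNormedType.Exports.

(** * The inversion cocycle of a Coxeter group *)

Section Length.
Local Open Scope group_scope.
Variables (W : finGroupType) (S : {set W}).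
Local Notation len := (coxeter_length S).
Local Notation wprod ws := (\prod_(s <- ws) s).

(** [coxeter_length] minimises over powers of the set [S]; words in [S] are
    easier to cut and concatenate. *)
Lemma expgs_wordP k (w : W) :
  reflect (exists ws, [/\ all [in S] ws, size ws = k & wprod ws = w])
    (w \in S ^+ k).
Proof.
elim: k w => [|k IHk] w.
  rewrite expg0; apply: (iffP set1P) => [->|[ws [_ /size0nil -> <-]]].
    by exists [::]; rewrite big_nil.
  by rewrite big_nil.
rewrite expgS; apply: (iffP mulsgP) => [[s v sS /IHk[ws [wsS <- <-]] ->]|].
  by exists (s :: ws); rewrite /= sS big_cons.
case=> [[|s ws] [//= /andP[sS wsS] [sz] <-]].
rewrite big_cons; exists s (wprod ws) => //.
by apply/IHk; exists ws.
Qed.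

Lemma coxeter_length_word ws : all [in S] ws -> (len (wprod ws) <= size ws)%N.
Proof.
move=> wsS; rewrite /coxeter_length -minEnat.
have [lt_ws|ge_ws] := ltnP (size ws) #|W|; last first.
  by apply: leq_trans ge_ws; rewrite -leEnat; apply: bigmin_le_id.
have Pws : wprod ws \in S ^+ Ordinal lt_ws by apply/expgs_wordP; exists ws.
exact: (bigmin_le_cond _ (P := fun i : 'I_#|W| => wprod ws \in S ^+ i)
  (fun i : 'I_#|W| => i : nat) Pws).
Qed.

Hypothesis genS : <<S>> = [set: W].

(** The default value #|W| of the minimum defining [coxeter_length] is never
    reached: a path without repetition in the Cayley graph has fewer than #|W|
    steps. *)
Lemma short_word (w : W) :
  exists ws, [/\ all [in S] ws, (size ws < #|W|)%N & wprod ws = w].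
Proof.
pose e (x y : W) := x^-1 * y \in S.
have cat_path x ws : all [in S] ws ->
  exists2 p, path e x p & last x p = x * wprod ws.
  elim: ws x => [|s ws IH] x /=; first by exists [::]; rewrite ?big_nil ?mulg1.
  case/andP=> sS /(IH (x * s))[p p_e lastp].
  by exists (x * s :: p); rewrite /= ?big_cons ?mulgA //= /e mulKg sS.
have path_word x p : path e x p ->
  exists ws, [/\ all [in S] ws, size ws = size p & x * wprod ws = last x p].
  elim: p x => [|y p IH] x /=; first by exists [::]; rewrite big_nil mulg1.
  case/andP=> xy /IH[ws [wsS sz <-]].
  by exists (x^-1 * y :: ws); rewrite /= wsS sz big_cons mulgA mulKVg; split=> //; apply/andP.
have /gen_prodgP[n [c cS ->]] : w \in <<S>> by rewrite genS inE.
have cS' : all [in S] [seq c i | i <- index_enum 'I_n].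
  by apply/allP=> _ /mapP[i _ ->]; apply: cS.
have [p p_e] := cat_path 1 _ cS'.
rewrite mul1g big_map => lastp.
case/shortenP: p_e lastp => p' p'_e Up' _ last'.
have [ws [wsS sz]] := path_word _ _ p'_e; rewrite mul1g last' => <-.
exists ws; split=> //; rewrite sz -ltnS.
by have := max_card (mem (1 :: p')); rewrite (card_uniqP Up').
Qed.

Lemma reduced_wordP (w : W) :
  exists ws, [/\ all [in S] ws, size ws = len w & wprod ws = w].
Proof.
have [ws [wsS ws_lt def_w]] := short_word w.
have: (len w == #|W|) || (w \in S ^+ len w).
  rewrite /coxeter_length.
  apply: (big_ind (fun k => (k == #|W|) || (w \in S ^+ k))).
  - by rewrite eqxx.
  - by move=> i j; rewrite /minn; case: ifP.
  - by move=> i ->; rewrite orbT.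
case/orP=> [/eqP len_w|/expgs_wordP //].
by have := coxeter_length_word wsS; rewrite def_w len_w leqNgt ws_lt.
Qed.

Lemma coxeter_length1 : len 1 = 0%N.
Proof.
by apply/eqP; rewrite -leqn0; have := @coxeter_length_word [::] isT; rewrite big_nil.
Qed.

Lemma coxeter_length_eq0 w : len w = 0%N -> w = 1.
Proof.
by have [ws [_ <- <-]] := reduced_wordP w => /size0nil ->; rewrite big_nil.
Qed.

Lemma coxeter_length_eq1 w : len w = 1%N -> w \in S.
Proof.
have [[|s [|s' ws]] [wsS <- <-]] := reduced_wordP w => //= _.
by move: wsS; rewrite big_seq1 /= andbT.
Qed.

Lemma leq_coxeter_lengthM x y : (len (x * y) <= len x + len y)%N.
Proof.
have [xs [xsS <- def_x]] := reduced_wordP x.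
have [ys [ysS <- def_y]] := reduced_wordP y.
by rewrite -def_x -def_y -big_cat -size_cat coxeter_length_word // all_cat xsS.
Qed.

Lemma leq_coxeter_length_simpleM s w : s \in S -> (len (s * w) <= (len w).+1)%N.
Proof.
move=> sS; have sS' : all [in S] [:: s] by rewrite /= sS.
have := coxeter_length_word sS'; rewrite big_seq1 => len_s.
by apply: leq_trans (leq_coxeter_lengthM s w) _; rewrite -add1n leq_add2r.
Qed.

(** Induction along reduced words; most identities about [T_w] below are
    proved this way. *)
Lemma coxeter_length_ind (P : W -> Prop) : P 1 ->
  (forall s w, s \in S -> len (s * w) = (len w).+1 -> P w -> P (s * w)) ->
  forall w, P w.
Proof.
move=> P1 Ps w; have [ws [wsS sz def_w]] := reduced_wordP w.
elim: ws => [|s ws IH] /= in w wsS sz def_w *; first by rewrite -def_w big_nil.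
case/andP: wsS => sS wsS; rewrite big_cons in def_w.
have le_ws := coxeter_length_word wsS.
have := leq_coxeter_length_simpleM (wprod ws) sS; rewrite def_w -sz => le_sws.
have len_ws : len (wprod ws) = size ws.
  by apply/eqP; rewrite eqn_leq le_ws -ltnS (leq_trans le_sws).
rewrite -def_w; apply: Ps => //; first by rewrite def_w -sz len_ws.
by apply: IH.
Qed.

End Length.

Section Inversions.
Local Open Scope group_scope.
Variables (W : finGroupType) (S : {set W}).
Hypothesis HS : coxeter_system S.
Local Notation len := (coxeter_length S).
Local Notation genS := (coxeter_gen HS).
Local Notation cind := (coxeter_length_ind genS).

Lemma simple_sqr s : s \in S -> s * s = 1.
Proof. by move=> sS; rewrite -expg2 -(coxeter_order2 HS sS) expg_order. Qed.

Lemma simpleV s : s \in S -> s^-1 = s.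
Proof. by move=> sS; apply/eqP; rewrite eq_invg_mul simple_sqr. Qed.

Lemma flip_inj (a : W) :
  injective (fun p : W * bool => (p.1 ^ a, p.2 (+) (p.1 == a))).
Proof.
by move=> [u d] [v e] /= [/conjg_inj -> /(can_inj (addbK _)) ->].
Qed.

(** The action of a simple reflection on pairs of a reflection and a sign, which
    is Tits' permutation model of the root system.  No roots are needed, and
    the formula makes sense on all of [W * bool]. *)
Definition flip (a : W) : {perm W * bool} := perm (@flip_inj a).

(** Each letter s_i of a word s_1 s_2 ... has an associated reflection
    s_1 ... s_i ... s_1.  [(flip a * flip b) ^+ k] changes the sign of [u] once
    for each letter of the alternating word of length 2k whose reflection is
    [u], and these reflections are the elements [(a * b) ^+ i * a]. *)
Definition dihedral_parity (a b : W) (k : nat) (u : W) : bool :=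
  odd (\sum_(i < k.*2) (u * a == (a * b) ^+ i)%g).

Lemma dihedralV a b k : a \in S -> b \in S ->
  a * (((a * b) ^+ k)^-1 * a) = (a * b) ^+ k.
Proof.
move=> aS bS; rewrite -{1}(simpleV aS) -/(conjg _ a) -expgVn conjXg conjVg.
by rewrite /conjg -[a * b * a]mulgA mulKg invMg !simpleV.
Qed.

Lemma flip_prodX a b k u e : a \in S -> b \in S ->
  ((flip a * flip b) ^+ k) (u, e) = (u ^ ((a * b) ^+ k), e (+) dihedral_parity a b k u).
Proof.
move=> aS bS; elim: k => [|k IH].
  by rewrite !expg0 perm1 conjg1 /dihedral_parity big_ord0 addbF.
rewrite expgSr !permM IH !permE /= -!conjgM -expgSr -!addbA; congr (_, _ (+) _).
rewrite /dihedral_parity doubleS !big_ord_recr /= !oddD !oddb -addbA.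
congr (_ (+) _); congr (_ (+) _).
  rewrite (canF_eq (conjgK _)) -(inj_eq (mulIg a)) /conjg invgK -!mulgA.
  by rewrite dihedralV // -expgD addnn.
rewrite (canF_eq (conjgK _)) -(inj_eq (mulIg a)) /conjg invgK !invMg -!mulgA.
rewrite (simpleV aS) dihedralV // !mulgA -(mulgA _ a b) -expgSr -expgD.
by rewrite addSn addnn.
Qed.

(** In the parity sum, the terms of index i and i + m, with m the order of
    [a * b], coincide, so every sign change occurs an even number of times.
    This is what allows the presentation of [W] to be used. *)
Lemma flip_relation a b : a \in S -> b \in S ->
  (flip a * flip b) ^+ #[a * b] = 1.
Proof.
move=> aS bS; apply/permP=> -[u e]; rewrite flip_prodX // perm1 expg_order conjg1.
congr (_, _); rewrite /dihedral_parity -addnn big_split_ord /=.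
rewrite -[RHS]addbF; congr (_ (+) _).
rewrite [X in _ + X](eq_bigr (fun i : 'I__ => nat_of_bool (u * a == (a * b) ^+ i)%g)).
  by rewrite addnn odd_double.
by move=> i _; rewrite expgD expg_order mul1g.
Qed.

Lemma flip_morphism :
  exists phi : {multiplicative W -> {perm W * bool}}, {in S, phi =1 flip}.
Proof. by apply: (coxeter_pres HS); apply: flip_relation. Qed.

(** [N w] is the set of reflections whose sign is changed by [w].  It turns out
    to be the set of left inversions of [w]; the lemmas below only use the
    cocycle identity and the values at simple reflections. *)
Lemma inversion_cocycle : exists N : W -> {set W},
  (forall s, s \in S -> N s = [set s]) /\
  (forall x y t, (t \in N (x * y)) = (t \in N x) (+) (t ^ x \in N y)).
Proof.
have [phi phiS] := flip_morphism.
have phi1 : phi 1 = 1 by apply: (mulgI (phi 1)); rewrite -gmulfM !mulg1.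
have phiE w u e : phi w (u, e) = (u ^ w, e (+) (phi w (u, false)).2).
  elim/cind: w u e => [|s w sS _ IH] u e; first by rewrite phi1 !perm1 conjg1 addbF.
  rewrite gmulfM !permM (phiS s sS) !permE /= IH [in RHS]IH /=.
  by rewrite -conjgM addbA.
exists (fun w => [set u | (phi w (u, false)).2]); split=> [s sS|x y t].
  by apply/finset.setP=> u; rewrite !inE phiS // permE.
by rewrite !inE gmulfM permM phiE /= phiE.
Qed.

Section Cocycle.
Variable N : W -> {set W}.
Hypothesis N_simple : forall s, s \in S -> N s = [set s].
Hypothesis N_mul : forall x y t, (t \in N (x * y)) = (t \in N x) (+) (t ^ x \in N y).
Local Notation T := (reflections S).

Lemma memJ_reflections t g : (t ^ g \in T) = (t \in T).
Proof.
by rewrite memJ_norm //; apply: (fintype.subsetP (class_support_norm S [set: W]%G)); rewrite inE.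
Qed.

Lemma reflection_sqr t : t \in T -> t * t = 1.
Proof. by case/imset2P=> s g sS _ ->; rewrite -conjMg simple_sqr // conj1g. Qed.

Lemma mem_inversions1 t : (t \in N 1) = false.
Proof. by have := N_mul 1 1 t; rewrite mulg1 conjg1 addbb. Qed.

Lemma mem_inversionsV x t : (t \in N x^-1) = (t ^ x^-1 \in N x).
Proof. by have := N_mul x^-1 x t; rewrite mulVg mem_inversions1; do 2!case: (_ \in _). Qed.

(** Conjugating [s] to [t] crosses the conjugating element twice, and the two
    contributions cancel, so [t] is flipped as [s] is. *)
Lemma reflection_mem_inversions t : t \in T -> t \in N t.
Proof.
case/imset2P=> s g sS _ ->; rewrite {2}/conjg N_mul mem_inversionsV conjgK N_mul (N_simple sS).
by rewrite finset.set11 /conjg mulKg; case: (_ \in _).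
Qed.

(** The sign of [t] can only be changed at a letter s_i of a reduced word of [w]
    with t = s_1 ... s_i ... s_1; left multiplication by [t] then deletes that
    letter. *)
Lemma strong_exchange w t : t \in N w -> t \in T /\ (len (t * w) < len w)%N.
Proof.
elim/cind: w t => [|s w sS len_sw IH] t; first by rewrite mem_inversions1.
rewrite N_mul (N_simple sS) inE; have [-> _|ne_ts /= /IH[tT lt_tw]] := eqVneq t s.
  by rewrite mulgA simple_sqr // mul1g len_sw; split=> //; rewrite mem_class_support.
rewrite memJ_reflections in tT; split=> //.
have -> : t * (s * w) = s * (t ^ s * w) by rewrite /conjg !mulgA mulgV mul1g.
by rewrite len_sw ltnS (leq_trans (leq_coxeter_length_simpleM genS _ sS)).
Qed.

Lemma simple_notin_inversions s w : s \in S -> len (s * w) = (len w).+1 -> s \notin N w.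
Proof.
by move=> sS len_sw; apply/negP=> /strong_exchange[_]; rewrite len_sw ltnNge leqnSn.
Qed.

Lemma inversions_simpleM s w : s \in S ->
  N (s * w) = (if s \in N w then N w :\ s else s |: N w) :^ s.
Proof.
move=> sS; apply/finset.setP=> t; rewrite mem_conjg simpleV // N_mul (N_simple sS) inE.
have -> : (t == s) = (t ^ s == s).
  by rewrite -(inj_eq (conjg_inj s)) {2}/conjg simpleV // mulgA simple_sqr // mul1g.
by case: ifP => sN; rewrite !inE; case: eqP => [->|]; rewrite ?sN.
Qed.

(** Sums of a class function over the letters of a reduced word of [w] are
    sums over the inversions of [w]. *)
Lemma sum_inversions_simpleM (V : nmodType) (f : W -> V) s w :
  (forall x y, f (x ^ y) = f x) -> s \in S -> len (s * w) = (len w).+1 ->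
  (\sum_(t in N (s * w)) f t = f s + \sum_(t in N w) f t)%R.
Proof.
move=> fJ sS len_sw; have sN := simple_notin_inversions sS len_sw.
rewrite inversions_simpleM // (negPf sN) (big_imset (h := fun x => x ^ s)) /=; last first.
  by move=> x y _ _ /conjg_inj.
by rewrite big_setU1 //= fJ; congr (_ + _)%R; apply: eq_bigr => t _; rewrite fJ.
Qed.

Lemma card_inversions w : #|N w| = len w.
Proof.
elim/cind: w => [|s w sS len_sw IH].
  by rewrite coxeter_length1; apply: eq_card0 => t; rewrite mem_inversions1.
rewrite inversions_simpleM // (negPf (simple_notin_inversions sS len_sw)) cardJg.
by rewrite cardsU1 (simple_notin_inversions sS len_sw) IH len_sw.
Qed.

End Cocycle.

Lemma coxeter_length_simple s : s \in S -> len s = 1%N.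
Proof.
have [N [N_simple N_mul]] := inversion_cocycle => sS.
by rewrite -(card_inversions N_simple N_mul) N_simple // cards1.
Qed.

Lemma coxeter_length_simpleM s w : s \in S ->
  len (s * w) = (len w).+1 \/ (len (s * w)).+1 = len w.
Proof.
have [N [N_simple N_mul]] := inversion_cocycle => sS.
rewrite -!(card_inversions N_simple N_mul) inversions_simpleM // cardJg.
case: ifP => sN; last by left; rewrite cardsU1 sN.
by right; rewrite (cardsD1 s (N w)) sN.
Qed.

Lemma coxeter_lengthV w : len w^-1 = len w.
Proof.
have [N [N_simple N_mul]] := inversion_cocycle.
rewrite -!(card_inversions N_simple N_mul) -(cardJg (N w) w); congr #|pred_of_set _|.
by apply/finset.setP=> t; rewrite mem_conjg (mem_inversionsV N_mul).
Qed.

Section Longest.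
Variable w0 : W.
Hypothesis Hw0 : is_longest S w0.
Local Notation T := (reflections S).

(** A reflection that is not an inversion of [w0] would make it longer. *)
Lemma inversions_longest (N : W -> {set W}) :
  (forall s, s \in S -> N s = [set s]) ->
  (forall x y t, (t \in N (x * y)) = (t \in N x) (+) (t ^ x \in N y)) ->
  N w0 = T.
Proof.
move=> N_simple N_mul; apply/finset.setP=> t; apply/idP/idP=> [|tT].
  by case/(strong_exchange N_simple N_mul).
apply: contraT => tN.
have /(strong_exchange N_simple N_mul)[_] : t \in N (t * w0).
  by rewrite N_mul reflection_mem_inversions // /conjg mulKg (negPf tN).
by rewrite mulgA reflection_sqr // mul1g ltnNge Hw0.
Qed.

Lemma coxeter_length_longest : len w0 = #|T|.
Proof.
have [N [N_simple N_mul]] := inversion_cocycle.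
by rewrite -(inversions_longest N_simple N_mul) (card_inversions N_simple N_mul).
Qed.

Lemma coxeter_length_longestM w : (len (w0 * w) + len w = len w0)%N.
Proof.
have [N [N_simple N_mul]] := inversion_cocycle.
have N_w0 := inversions_longest N_simple N_mul.
have sNT x : N x \subset T.
  by apply/fintype.subsetP=> t /(strong_exchange N_simple N_mul)[].
have -> : len (w0 * w) = #|T :\: N w|.
  rewrite -(card_inversions N_simple N_mul) -(cardJg _ w0); congr #|pred_of_set _|.
  apply/finset.setP=> t; rewrite mem_conjg inE N_mul N_w0 memJ_reflections conjgKV.
  by have := fintype.subsetP (sNT w) t; case: (t \in N w) => [->|_] //; rewrite addbF.
rewrite -(card_inversions N_simple N_mul) coxeter_length_longest.
by rewrite -(cardsID (N w) T) (finset.setIidPr (sNT w)) addnC.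
Qed.

Lemma longest_sqr : w0 * w0 = 1.
Proof.
apply: (coxeter_length_eq0 genS).
by have := coxeter_length_longestM w0 => /eqP; rewrite -[X in _ == X]add0n eqn_add2r => /eqP.
Qed.

(** Multiplication by [w0] reverses the length, so conjugation by [w0]
    preserves it and hence permutes the elements of length 1. *)
Lemma longest_simpleJ s : s \in S -> s ^ w0 \in S.
Proof.
move=> sS; apply: (coxeter_length_eq1 genS).
have w0V : w0^-1 = w0 by apply/eqP; rewrite eq_invg_mul longest_sqr.
rewrite /conjg w0V.
have E1 := coxeter_length_longestM (s * w0); have E2 := coxeter_length_longestM s.
rewrite -(coxeter_lengthV (s * w0)) invMg w0V simpleV // in E1.
rewrite (coxeter_length_simple sS) in E2.
by apply/eqP; rewrite -(eqn_add2r (len (w0 * s))) E1 -E2 addnC.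
Qed.

End Longest.
End Inversions.

(** * Matrices with a quadratic equation, Schur's lemma *)

Local Open Scope complex_scope.
Local Open Scope ring_scope.

(** Sylvester's identity, from two block triangular factorizations of one
    matrix. *)
Lemma det_1addM_comm (R : comRingType) m n (X : 'M[R]_(m, n)) (Y : 'M[R]_(n, m)) :
  \det (1%:M + X *m Y) = \det (1%:M + Y *m X).
Proof.
pose B := block_mx 1%:M (- X) Y 1%:M.
have B1 : B = block_mx 1%:M 0 Y 1%:M *m block_mx 1%:M (- X) 0 (1%:M + Y *m X).
  by rewrite mulmx_block ?mulmx1 ?mul1mx ?mul0mx ?mulmx0 !addr0 mulmxN addrCA addNr addr0.
have B2 : B = block_mx 1%:M (- X) 0 1%:M *m block_mx (1%:M + X *m Y) 0 Y 1%:M.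
  by rewrite mulmx_block ?mulmx1 ?mul1mx ?mul0mx ?mulmx0 !add0r mulNmx addrK.
have := erefl (\det B); rewrite {1}B1 B2 !det_mulmx !det_ublock !det_lblock !det1.
by rewrite !mul1r !mulr1.
Qed.

(** Rank factorization of [c^-1 *: B], which is idempotent. *)
Lemma scaled_idempotent_base (F : fieldType) d (B : 'M[F]_d) (c : F) :
  c != 0 -> B *m B = c *: B ->
  exists (C : 'M[F]_(d, \rank B)) (L : 'M[F]_(\rank B, d)),
    B = c *: (C *m L) /\ L *m C = 1%:M.
Proof.
move=> c0 BB; exists (col_base B), (c^-1 *: row_base B); split.
  by rewrite -scalemxAr mulmx_base scalerA mulfV // scale1r.
apply: (row_free_inj (row_base_free B)); apply: (row_full_inj (col_base_full B)).
rewrite /= mul1mx mulmx_base -!scalemxAl -scalemxAr -mulmxA mulmx_base.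
by rewrite (mulmxA (col_base B)) mulmx_base BB scalerA mulVf // scale1r.
Qed.

(** Such an [A] is diagonalizable with eigenvalues q and -1, and m is the
    multiplicity of q; a rank factorization replaces the diagonalization. *)
Section Quadratic.
Variables (F : fieldType) (d : nat) (A : 'M[F]_d) (q : F).
Hypotheses (q1 : q + 1 != 0) (Aq : (A - q%:M) *m (A + 1%:M) = 0).
Local Notation m := (\rank (A + 1%:M)%R).

Lemma quadratic_base : exists (C : 'M[F]_(d, m)) (L : 'M[F]_(m, d)),
  A = (q + 1) *: (C *m L) - 1%:M /\ L *m C = 1%:M.
Proof.
have [|C [L [defA LC]]] := scaled_idempotent_base q1 (B := A + 1%:M).
  rewrite -[X in X *m _](_ : (A - q%:M) + (q + 1)%:M = A + 1%:M).
    by rewrite mulmxDl Aq add0r mul_scalar_mx.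
  by rewrite raddfD /= addrA subrK.
by exists C, L; rewrite -defA addrK.
Qed.

Lemma quadratic_trace : \tr A = (q + 1) * m%:R - d%:R.
Proof.
have [C [L [defA LC]]] := quadratic_base; rewrite {1}defA.
by rewrite raddfB /= mxtraceZ mxtrace_mulC LC !mxtrace1.
Qed.

Lemma quadratic_det_sqr : \det A ^+ 2 = q ^+ (2 * m).
Proof.
have [C [L [defA LC]]] := quadratic_base; rewrite {1}defA.
have -> : (q + 1) *: (C *m L) - 1%:M = - (1%:M + C *m (- (q + 1) *: L)).
  by rewrite -scalemxAr scaleNr opprD opprK addrC.
rewrite -scaleN1r detZ det_1addM_comm -scalemxAl LC.
have -> : 1%:M + - (q + 1) *: 1%:M = (- q)%:M :> 'M[F]_m.
  by rewrite scale_scalar_mx mulr1 -raddfD /= opprD addrCA subrr addr0.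
by rewrite det_scalar exprMn -!exprM mulnC exprM sqrrN expr1n expr1n mul1r mulnC exprM sqrrN -exprM.
Qed.
End Quadratic.

Lemma mxtrace_intertwine (F : fieldType) m n (K : 'M[F]_m) (D : 'M[F]_n) (Phi : 'M[F]_(m, n)) :
  row_free Phi -> m = n -> K *m Phi = Phi *m D -> \tr K = \tr D.
Proof.
move=> Phi_free mn; case: n / mn D Phi Phi_free => D Phi; rewrite row_free_unit => Phi_unit KD.
by rewrite -[K](mulmxK Phi_unit) KD -mulmxA mxtrace_mulC -mulmxA mulVmx // mulmx1.
Qed.

Lemma eigenvalue_closed (F : closedFieldType) n (B : 'M[F]_n) :
  (0 < n)%N -> exists c, eigenvalue B c.
Proof.
case: n B => // n B _.
have /closed_rootP[c] : size (char_poly B) != 1%N by rewrite size_char_poly.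
by rewrite -eigenvalue_root_char; exists c.
Qed.

Section AlgRepr.
Variables (F : closedFieldType) (A : falgType F) (n : nat) (rho : A -> 'M[F]_n).
Hypothesis irr : alg_irreducible rho.

(** Schur's lemma: an eigenspace of [B] is stable under [rho], hence full. *)
Lemma alg_schur (B : 'M[F]_n) :
  (forall a, B *m rho a = rho a *m B) -> exists c, B = c%:M.
Proof.
have [_ n_gt0 irrU] := irr => cB.
have [c /eigenvalueP[v vB v0]] := eigenvalue_closed B n_gt0.
exists c; apply/eqP; rewrite -subr_eq0; set D := B - _.
have /row_fullP[E EK] : row_full (kermx D).
  apply: irrU => [a|].
    apply/sub_kermxP.
    have cD : rho a *m D = D *m rho a by rewrite mulmxBr mulmxBl cB scalar_mxC.
    by rewrite -mulmxA cD mulmxA mulmx_ker mul0mx.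
  rewrite kermx_eq0; apply: contra v0 => /row_free_inj D_inj.
  by apply/eqP/D_inj; rewrite /= mul0mx mulmxBr vB mul_mx_scalar subrr.
by rewrite -[D]mul1mx -EK -mulmxA mulmx_ker mulmx0.
Qed.
End AlgRepr.

(** * Continuous functions with countably many values *)

Section Constancy.
Local Open Scope classical_set_scope.
Local Open Scope ring_scope.
Variable R : realType.

(** By the intermediate value theorem the range of f contains the interval
    between two of its values; a countable range has Lebesgue measure 0, so
    this interval is a point. *)
Lemma continuous_countable_const_real (f : R -> R) :
  (forall r, 0 < r -> {for r, continuous f}) -> countable (f @` [set r | 0 < r]) ->
  forall a b, 0 < a -> 0 < b -> f a = f b.
Proof.
move=> f_cont f_count a b a0 b0; wlog ab : a b a0 b0 / a <= b.
  by move=> IH; case: (leP a b) => [|/ltW] ab; [|apply/esym]; apply: IH.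
set u := Order.min (f a) (f b); set v := Order.max (f a) (f b).
have uv_range : `[u, v] `<=` f @` [set r | 0 < r].
  move=> y /=; rewrite in_itv /= => /(IVT ab)[].
    apply: continuous_in_subspaceT => x; rewrite inE /= in_itv /= => /andP[ax _].
    by apply: f_cont; apply: lt_le_trans ax.
  move=> x; rewrite in_itv /= => /andP[ax _] <-; exists x => //=.
  exact: lt_le_trans ax.
have := countable_lebesgue_measure0 (sub_countable (subset_card_le uv_range) f_count).
rewrite lebesgue_measure_itv /= lte_fin /u /v; case: (ltgtP (f a) (f b)) => // f_ab.
  by rewrite f_ab => /eqP; rewrite -EFinB eqe subr_eq0 => /eqP ->.
by rewrite f_ab => /eqP; rewrite -EFinB eqe subr_eq0 => /eqP ->.
Qed.

Lemma real_complex_continuous : continuous ((fun r : R => r%:C) : R -> R[i]^o).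
Proof.
move=> r; apply/cvgrPdist_lt => /= e e0.
have e_real : e = (complex.Re e)%:C by case: e e0 => x y; rewrite ltcE /= => /andP[/eqP -> _].
have Re_e0 : 0 < complex.Re e by move: e0; rewrite e_real ltcR.
near=> x.
rewrite -raddfB /= e_real normc_def /= expr0n addr0 sqrtr_sqr ltcR.
near: x; exact: cvgr_dist_lt.
Unshelve. all: by end_near.
Qed.

Lemma part_continuous_at (g : R[i] -> R) (f : R -> R[i]) (r : R) :
  (forall z w, `|g z - g w|%:C <= `|z - w|) ->
  {for r, continuous (f : R -> R[i]^o)} -> {for r, continuous (g \o f)}.
Proof.
move=> g_le f_cont; apply/cvgrPdist_lt => /= e e0.
have /cvgrPdist_lt /(_ e%:C) /= := f_cont; rewrite ltcR => /(_ e0).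
by apply: filterS => x fx; rewrite -ltcR; apply: le_lt_trans (g_le _ _) fx.
Qed.

(** The rigidity of a continuous deformation: dimensions, multiplicities and
    roots of unity cannot vary. *)
Lemma continuous_countable_const (f : R -> R[i]) (v : nat -> R[i]) :
  (forall r, 0 < r -> {for r, continuous (f : R -> R[i]^o)}) ->
  (forall r, 0 < r -> exists k, f r = v k) ->
  forall a b, 0 < a -> 0 < b -> f a = f b.
Proof.
move=> f_cont f_count a b a0 b0.
have count (g : R[i] -> R) : countable ((g \o f) @` [set r | 0 < r]).
  apply: (@sub_countable _ _ _ [set: nat]); last exact: countableP.
  apply: card_le_trans (card_image_le (g \o v) _); apply: subset_card_le.
  by move=> _ [r /= /f_count[k ->] <-]; exists k.
have const (g : R[i] -> R) : (forall z w, `|g z - g w|%:C <= `|z - w|) -> g (f a) = g (f b).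
  move=> g_le; apply: (continuous_countable_const_real (f := g \o f)) => // r r0.
  exact: part_continuous_at g_le (f_cont r r0).
apply/eqP; rewrite eq_complex; apply/andP; split; apply/eqP; apply: const.
  by move=> [x y] [z w]; apply: (normc_ge_Re ((x +i* y) - (z +i* w))).
move=> [x y] [z w]; rewrite [leRHS]normc_def lecR /= -sqrtr_sqr ler_wsqrtr //.
by rewrite lerDr sqr_ge0.
Qed.

End Constancy.

(** * Multiplication and symmetrizing trace of the Hecke algebra *)

Section Hecke.
Variables (R : realType) (W : finGroupType) (S : {set W}).
Hypothesis HS : coxeter_system S.
Local Notation len := (coxeter_length S).
Local Notation cind := (coxeter_length_ind (coxeter_gen HS)).

Section Basis.
Variables (q : R) (H : hecke_algebra S q).
Local Notation T := (hecke_T H).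

Definition hecke_coef (w : W) : H -> R[i] := coord (codom_tuple T) (enum_rank w).

HB.instance Definition _ w := GRing.Linear.copy (hecke_coef w) (hecke_coef w).

Lemma nth_codom_hecke w : (codom_tuple T)`_(enum_rank w) = T w.
Proof. by rewrite /= codomE (nth_map w) ?nth_enum_rank // -cardE. Qed.

Lemma hecke_coefT w v : hecke_coef w (T v) = (w == v)%:R.
Proof.
rewrite /hecke_coef -nth_codom_hecke coord_free ?(basis_free (hecke_basis H)) //.
by rewrite (inj_eq enum_rank_inj) eq_sym.
Qed.

Lemma hecke_expand h : h = \sum_w hecke_coef w h *: T w.
Proof.
have := coord_span (X := codom_tuple T) (v := h).
rewrite (span_basis (hecke_basis H)) memvf => /(_ isT) {1}->.
rewrite (reindex_onto enum_rank enum_val) /=; last by move=> i _; rewrite enum_valK.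
apply: eq_big => [w|w _]; first by rewrite enum_rankK eqxx.
by rewrite nth_codom_hecke.
Qed.

Lemma hecke_ind (P : H -> Prop) : (forall a x y, P x -> P y -> P (a *: x + y)) ->
  (forall w, P (T w)) -> forall h, P h.
Proof.
move=> Plin PT h; rewrite (hecke_expand h).
elim/big_rec: _ => [|w x _ Px]; last exact: Plin.
by rewrite -(addNr (T 1%g)) -scaleN1r; apply: Plin.
Qed.

Lemma heckeT_simpleM s w : s \in S -> T s * T w =
  if len (s * w) == (len w).+1 then T (s * w)%g
  else (q - 1)%:C *: T w + q%:C *: T (s * w)%g.
Proof.
move=> sS; case: eqP => [|/eqP ne]; first exact: hecke_mul_up.
apply: hecke_mul_down => //.
by have [E|//] := coxeter_length_simpleM HS w sS; rewrite E eqxx in ne.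
Qed.

(** The quadratic relation of [T_s] applied to [T_w], which can be stated before
    [T_1] is known to be the unit. *)
Lemma heckeT_simple_sqrM s w : s \in S ->
  T s * (T s * T w) = (q - 1)%:C *: (T s * T w) + q%:C *: T w.
Proof.
move=> sS; have ssw : (s * (s * w) = w)%g by rewrite mulgA (simple_sqr HS sS) mul1g.
have [up|down] := coxeter_length_simpleM HS w sS.
  by rewrite (hecke_mul_up H sS up) hecke_mul_down ?ssw.
rewrite {1}(hecke_mul_down H sS down) mulrDr -!scalerAr.
by rewrite (hecke_mul_up H sS (w := s * w)%g) ssw.
Qed.

End Basis.

Variables (q : R) (H : hecke_algebra S q) (s0 : W).
Hypotheses (q0 : q != 0) (s0S : s0 \in S).
Local Notation T := (hecke_T H).
Local Notation tau := (hecke_coef (H := H) 1%g).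

Lemma paramC_neq0 : q%:C != 0 :> R[i].
Proof. by rewrite -(rmorph0 (real_complex R)) (inj_eq (@complexI _)). Qed.

(** The multiplication rules only concern left multiplication by simple
    generators.  They express [T_1] through some [T_s], and then show that
    [T_1] is a left unit; without any simple reflection the value of [T_1] is
    not determined. *)
Lemma heckeT1 : T 1%g = 1.
Proof.
have T1T w : T 1%g * T w = T w.
  apply: (scalerI paramC_neq0); rewrite scalerAl.
  have -> : q%:C *: T 1%g = T s0 * T s0 - (q - 1)%:C *: T s0.
    rewrite (hecke_mul_down (w := s0) H s0S) ?(simple_sqr HS s0S) ?coxeter_length1
      ?(coxeter_length_simple HS s0S) //.
    by rewrite addrC addKr.
  by rewrite mulrBl -mulrA -scalerAl heckeT_simple_sqrM // addrC addKr.
have T1l a : T 1%g * a = a.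
  elim/(hecke_ind (H := H)): a => [a x y Px Py|//].
  by rewrite mulrDr -scalerAr Px Py.
by rewrite -[RHS]T1l mulr1.
Qed.

Lemma heckeT_mul x y : len (x * y) = (len x + len y)%N -> T x * T y = T (x * y)%g.
Proof.
elim/cind: x => [|s x sS len_sx IH]; first by rewrite heckeT1 !mul1r mul1g.
rewrite len_sx -mulgA => len_xy.
have len_xy' : len (x * y) = (len x + len y)%N.
  apply/eqP; rewrite eqn_leq leq_coxeter_lengthM ?coxeter_gen //=.
  have := leq_coxeter_length_simpleM (coxeter_gen HS) (x * y) sS.
  by rewrite len_xy addSn ltnS.
rewrite -(hecke_mul_up H sS len_sx) -mulrA IH // hecke_mul_up //.
by rewrite len_xy len_xy'.
Qed.

Lemma heckeT_quadratic s : s \in S -> (T s - q%:C%:A) * (T s + 1) = 0.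
Proof.
move=> sS; rewrite mulrDr mulr1 mulrBl -scalerAl mul1r.
rewrite (hecke_mul_down (w := s) H sS) (simple_sqr HS sS) ?coxeter_length1
  ?(coxeter_length_simple HS sS) //.
rewrite heckeT1 raddfB /= rmorph1 scalerBl scale1r -[_ - _ + _ *: 1]addrA.
by rewrite [_ *: T s + _]addrC addrK [- _ + _]addrC -opprB addNr.
Qed.

Lemma coxeter_length_ind_r (P : W -> Prop) : P 1%g ->
  (forall s w, s \in S -> len (w * s) = (len w).+1 -> P w -> P (w * s)%g) ->
  forall w, P w.
Proof.
move=> P1 Ps w; rewrite -[w]invgK; elim/cind: w^-1%g => [|s v sS len_sv Pv].
  by rewrite invg1.
rewrite invMg (simpleV HS sS); apply: Ps => //.
by rewrite -(coxeter_lengthV HS) invMg invgK (simpleV HS sS) len_sv coxeter_lengthV.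
Qed.

Lemma heckeT_mulS w s : s \in S -> len (w * s) = (len w).+1 -> T (w * s)%g = T w * T s.
Proof. by move=> sS E; rewrite heckeT_mul // (coxeter_length_simple HS sS) addn1. Qed.

(** The last letter of x can be moved from [T_x] to [T_y].  In each case of the
    multiplication rule for [T_s * T_y], length considerations exclude the
    unwanted term. *)
Lemma hecke_trace_mul x y : tau (T x * T y) = q%:C ^+ len x * (x * y == 1)%g%:R.
Proof.
elim/coxeter_length_ind_r: x y => [|s x sS len_xs IH] y.
  by rewrite heckeT1 mul1r mul1g hecke_coefT coxeter_length1 mul1r eq_sym.
rewrite heckeT_mulS // -mulrA heckeT_simpleM // len_xs.
have ne_len z : (x * (s * z) == 1)%g -> len z = (len (s * z)).+1.
  rewrite -eq_invg_mul => /eqP E; rewrite -E (coxeter_lengthV HS) // -len_xs.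
  rewrite -[len (x * s)](coxeter_lengthV HS) invMg E (simpleV HS sS).
  by rewrite mulgA (simple_sqr HS sS) mul1g.
case: ifP => [/eqP len_sy|len_sy].
  rewrite IH -mulgA; case: eqP => [/eqP/ne_len E|_]; last by rewrite !mulr0.
  by have := ltnn (len (s * y)); rewrite {2}len_sy E ltnS leqnSn.
rewrite mulrDr -!scalerAr linearD !linearZ /= !IH.
(* If x y = 1 then s y = (x s)^-1 is longer than y, against len_sy. *)
case: (x * y == 1)%g / eqP => [/eqP E|_].
  have := ne_len (s * y)%g; rewrite (mulgA s) (simple_sqr HS sS) mul1g => /(_ E) E'.
  by rewrite E' eqxx in len_sy.
by rewrite mulr0 mulr0 add0r exprS -!mulrA mulgA.
Qed.

(** Up to the factor q^len w, [T_(w^-1)] is dual to [T_w]. *)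
Lemma hecke_trace_nondegenerate a : (forall b, tau (b * a) = 0) -> a = 0.
Proof.
move=> tau0; rewrite (hecke_expand a) big1 // => w _.
have := tau0 (T w^-1%g); rewrite {1}(hecke_expand a) mulr_sumr linear_sum /=.
rewrite (bigD1 w) //= big1 ?addr0 => [|v ne_vw]; last first.
  rewrite -scalerAr linearZ /= hecke_trace_mul.
  by rewrite -eq_invg_mul invgK eq_sym (negPf ne_vw) !mulr0.
rewrite -scalerAr linearZ /= hecke_trace_mul mulVg eqxx mulr1 => /eqP.
rewrite mulf_eq0 expf_eq0 => /orP[/eqP->|]; first by rewrite scale0r.
by case/andP=> _ /eqP q0'; have := paramC_neq0; rewrite q0' eqxx.
Qed.

(** Two reduced factorizations of [w0], one ending in s and one beginning with
    its conjugate by [w0], give [T_w0 * T_s = T_(s ^ w0) * T_w0]; conjugating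
    twice by the involution [w0] gives back s. *)
Lemma hecke_central w0 : is_longest S w0 -> forall a, T w0 ^+ 2 * a = a * T w0 ^+ 2.
Proof.
move=> Hw0.
have braid s : s \in S -> T w0 * T s = T (s ^ w0)%g * T w0.
  move=> sS; have s'S := longest_simpleJ HS Hw0 sS.
  have E := coxeter_length_longestM HS Hw0 s; rewrite (coxeter_length_simple HS sS) addn1 in E.
  have w0_ws : w0 = (w0 * s * s)%g by rewrite -mulgA (simple_sqr HS sS) mulg1.
  have w0_sw : w0 = (s ^ w0 * (w0 * s))%g.
    rewrite /conjg !mulgA -(mulgA _ w0 w0) (longest_sqr HS Hw0) mulg1 -(mulgA w0^-1%g).
    by rewrite (simple_sqr HS sS) mulg1; apply/esym/eqP; rewrite eq_invg_mul (longest_sqr HS Hw0).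
  have E1 : T w0 = T (w0 * s)%g * T s by rewrite -heckeT_mulS -?w0_ws.
  have E2 : T w0 = T (s ^ w0)%g * T (w0 * s)%g by rewrite hecke_mul_up -?w0_sw.
  by rewrite {1}E2 -mulrA -E1.
have comm_s s : s \in S -> T w0 ^+ 2 * T s = T s * T w0 ^+ 2.
  move=> sS; have s'S := longest_simpleJ HS Hw0 sS.
  rewrite expr2 -mulrA braid // mulrA braid // -mulrA -conjgM (longest_sqr HS Hw0).
  by rewrite conjg1.
elim/(hecke_ind (H := H)) => [c x y Px Py|w].
  by rewrite mulrDr mulrDl -scalerAr -scalerAl Px Py.
elim/cind: w => [|s w sS len_sw IH]; first by rewrite heckeT1 mul1r mulr1.
by rewrite -hecke_mul_up // mulrA comm_s // -mulrA IH mulrA.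
Qed.

Lemma heckeT_mul1 x y : q = 1 -> T x * T y = T (x * y)%g.
Proof.
move=> q1; elim/cind: x => [|s x sS len_sx IH]; first by rewrite heckeT1 !mul1r mul1g.
rewrite -hecke_mul_up // -mulrA IH heckeT_simpleM // mulgA.
case: ifP => // _; have -> : (q - 1)%:C = 0 :> R[i] by rewrite q1 subrr.
have -> : q%:C = 1 :> R[i] by rewrite q1.
by rewrite scale0r add0r scale1r.
Qed.

End Hecke.

(** * The scalar by which the square of the longest element acts *)

Section AlgReprTheory.
Variables (F : fieldType) (A : falgType F) (n : nat) (rho : A -> 'M[F]_n).
Hypothesis repr : alg_repr rho.

Lemma alg_reprD x y : rho (x + y) = rho x + rho y.
Proof. by case: repr => lin _ _; have := lin 1 x y; rewrite !scale1r. Qed.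

Lemma alg_repr0 : rho 0 = 0.
Proof. by apply: (addrI (rho 0)); rewrite -alg_reprD !addr0. Qed.

Lemma alg_reprZ a x : rho (a *: x) = a *: rho x.
Proof. by case: repr => lin _ _; have := lin a x 0; rewrite alg_repr0 !addr0. Qed.

Lemma alg_repr_sum (I : finType) (f : I -> A) : rho (\sum_i f i) = \sum_i rho (f i).
Proof. exact: (big_morph rho alg_reprD alg_repr0). Qed.

Lemma alg_repr1 : rho 1 = 1%:M. Proof. by case: repr. Qed.

Lemma alg_reprM x y : rho (x * y) = rho x *m rho y. Proof. by case: repr. Qed.

Lemma alg_repr_scalarX x c k : rho x = c%:M -> rho (x ^+ k) = (c ^+ k)%:M.
Proof.
move=> rx; elim: k => [|k IH]; first by rewrite !expr0 alg_repr1.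
by rewrite !exprS alg_reprM IH rx -scalar_mxM.
Qed.
End AlgReprTheory.

Section Continuity.
Local Open Scope classical_set_scope.
Local Open Scope ring_scope.
Variable R : realType.

Lemma eq_pos_continuous_at (f g : R -> R[i]) : (forall r, 0 < r -> f r = g r) ->
  forall r, 0 < r -> {for r, continuous (g : R -> R[i]^o)} -> {for r, continuous (f : R -> R[i]^o)}.
Proof.
move=> fg r r0 g_cont; rewrite /prop_for /continuous_at fg //.
apply: cvg_trans g_cont; apply: near_eq_cvg; near=> x.
by apply/esym/fg; near: x; exact: lt_nbhsr.
Unshelve. all: by end_near.
Qed.

Lemma powRC_continuous_at (x r : R) : 0 < r ->
  {for r, continuous ((fun r => (r `^ x)%:C) : R -> R[i]^o)}.
Proof.
move=> r0; have c : {for r, continuous (fun y : R => y `^ x)}.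
  apply/differentiable_continuous/derivable1_diffP/derivable_powR.
  by rewrite in_itv /= r0.
exact: (continuous_comp c (@real_complex_continuous R (r `^ x))).
Qed.

End Continuity.

Section HeckeRepr.
Variables (R : realType) (W : finGroupType) (S : {set W}).
Hypothesis HS : coxeter_system S.
Local Notation len := (coxeter_length S).
Variables (s0 : W) (s0S : s0 \in S).

Section Fixed.
Variables (q : R) (q0 : 0 < q) (H : hecke_algebra S q).
Local Notation T := (hecke_T H).
Variables (n : nat) (rho : H -> 'M[R[i]]_n).
Hypothesis irr : alg_irreducible rho.

Let repr : alg_repr rho. Proof. by case: irr. Qed.
Let qn0 : q != 0. Proof. by rewrite gt_eqF. Qed.

Lemma paramC_add1_neq0 : q%:C + 1 != 0 :> R[i].
Proof.
rewrite -(rmorph1 (real_complex R)) -rmorphD /= -(rmorph0 (real_complex R)).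
by rewrite (inj_eq (@complexI _)) gt_eqF // addr_gt0.
Qed.

Lemma repr_heckeT_quadratic s : s \in S ->
  (rho (T s) - q%:C%:M) *m (rho (T s) + 1%:M) = 0.
Proof.
move=> sS; rewrite -(alg_repr1 repr) -[q%:C%:M]scalemx1 -(alg_repr1 repr).
rewrite -(alg_reprZ repr) -scaleN1r -(alg_reprZ repr) -!(alg_reprD repr) scaleN1r.
by rewrite -(alg_reprM repr) (heckeT_quadratic HS H qn0 s0S sS) (alg_repr0 repr).
Qed.

Lemma trace_heckeT s : s \in S ->
  \tr (rho (T s)) = (q%:C + 1) * (\rank (rho (T s) + 1%:M)%R)%:R - n%:R.
Proof. by move=> sS; apply: quadratic_trace paramC_add1_neq0 (repr_heckeT_quadratic sS). Qed.

(** The determinant is multiplicative along a reduced word of [w0], each letter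
    contributing the multiplicity of the eigenvalue q; the letters correspond
    to the reflections of W, each occurring once.  Squaring removes the signs
    coming from the eigenvalue -1. *)
Lemma det_heckeT_longest (m : W -> nat) (w0 : W) : is_longest S w0 ->
  (forall x y, m (x ^ y)%g = m x) ->
  (forall s, s \in S -> \rank (rho (T s) + 1%:M)%R = m s) ->
  \det (rho (T w0)) ^+ 2 = q%:C ^+ (2 * \sum_(t in reflections S) m t).
Proof.
move=> Hw0 mJ rank_m; have [N [N_simple N_mul]] := inversion_cocycle HS.
rewrite -(inversions_longest HS Hw0 N_simple N_mul).
elim/(coxeter_length_ind (coxeter_gen HS)): w0 {Hw0} => [|s w sS len_sw IH].
  rewrite (heckeT1 HS H qn0 s0S) (alg_repr1 repr) det1 expr1n big1 ?muln0 // => t.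
  by rewrite (mem_inversions1 N_mul).
rewrite -(hecke_mul_up H sS len_sw) (alg_reprM repr) det_mulmx exprMn IH.
rewrite (quadratic_det_sqr paramC_add1_neq0 (repr_heckeT_quadratic sS)) rank_m //.
rewrite (sum_inversions_simpleM HS N_simple N_mul (f := m)) // -exprD.
by rewrite mulnDr.
Qed.

Lemma heckeT_longest_sqr_scalar (w0 : W) : is_longest S w0 ->
  exists z, rho (T w0 ^+ 2) = z%:M.
Proof.
move=> Hw0; apply: (alg_schur irr) => a.
by rewrite -!(alg_reprM repr) (hecke_central HS qn0 s0S Hw0).
Qed.

End Fixed.

Lemma in_group_setT (x : W) : x \in [set: W]%G.
Proof. by rewrite inE. Qed.

Lemma rank_reprJ (F : fieldType) d (rG : mx_representation F [set: W]%G d) x y :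
  \rank (rG (x ^ y)%g + 1%:M)%R = \rank (rG x + 1%:M)%R.
Proof.
have y_unit : rG y \in unitmx by rewrite repr_mx_unit ?in_group_setT.
have -> : rG (x ^ y)%g + 1%:M = invmx (rG y) *m (rG x + 1%:M) *m rG y.
  rewrite mulmxDr mulmxDl mulmx1 mulVmx // /conjg !repr_mxM ?in_group_setT //.
  by rewrite repr_mxV ?in_group_setT // mulmxA.
rewrite mxrankMfree ?row_free_unit // eqmxMfull //.
by rewrite row_full_unit unitmx_inv.
Qed.

Section IrrW.
Variable lam : Irr R W.
Local Notation d := (dimW lam).

Lemma dimW_gt0 : (0 < d)%N. Proof. exact: irr_degree_gt0. Qed.

Lemma charW1 : charW lam 1%g = d%:R.
Proof. by rewrite /charW repr_mx1 mxtrace1. Qed.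

(** The multiplicity of the eigenvalue 1 of [t], when [t] is a reflection. *)
Definition plus_mult (t : W) : nat := \rank (irr_repr lam t + 1%:M)%R.

Lemma plus_multJ x y : plus_mult (x ^ y)%g = plus_mult x.
Proof. exact: rank_reprJ. Qed.

Lemma charW_reflection t : t \in reflections S ->
  charW lam t = 2 * (plus_mult t)%:R - d%:R.
Proof.
move=> tT; have two : 2 = 1 + 1 :> R[i] by [].
rewrite /charW two; apply: quadratic_trace; first by rewrite -two pnatr_eq0.
rewrite mulmxDr mulmx1 mulmxBl -(repr_mxM _ (in_group_setT t) (in_group_setT t)).
rewrite (reflection_sqr HS tT) repr_mx1 mul1mx.
by rewrite addrC addrA subrK subrr.
Qed.

(** Since chi(t) = 2 m(t) - d for a reflection t, the sum of the multiplicities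
    is governed by the content. *)
Lemma sum_plus_mult :
  (2 * \sum_(t in reflections S) plus_mult t)%:R =
  d%:R * (#|reflections S|%:R + refl_content S lam) :> R.
Proof.
have dC0 : d%:R != 0 :> R[i] by rewrite pnatr_eq0 -lt0n dimW_gt0.
have d0 : d%:R != 0 :> R by rewrite pnatr_eq0 -lt0n dimW_gt0.
set M := (\sum_(t in _) _)%N.
have sum_char : \tr (gring_op (irr_repr lam) (gset_mx R[i] [set: W]%SET (reflections S)))
    = ((2 * M)%:R - (d * #|reflections S|)%:R)%:C.
  rewrite /gset_mx linear_sum /= raddf_sum /=.
  rewrite (eq_bigr (fun t => 2 * (plus_mult t)%:R - d%:R)); last first.
    by move=> t tT; rewrite gring_opG ?inE // -/(charW lam t) charW_reflection.
  rewrite sumrB -mulr_sumr sumr_const -natr_sum -/M rmorphB /= !rmorph_nat.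
  by rewrite !natrM -[_ *+ #|_|]mulr_natr.
rewrite /refl_content sum_char -(rmorph_nat (real_complex R)) -fmorph_div /=.
by rewrite mulrDr mulrCA divff // mulr1 !natrM addrC subrK.
Qed.

End IrrW.

Lemma dimW_triv : dimW [1 Irr R W]%irr = 1%N. Proof. exact: degree_irr1. Qed.

Lemma sum_sqr_dimW : (\sum_(lam : Irr R W) dimW lam ^ 2)%N = #|W|.
Proof.
rewrite sum_irr_degree_pchar ?cardsT //; last exact: group_closure_closed_field.
by apply/pgroup.pgroupP=> p _; rewrite inE /= pchar_num.
Qed.

(** The group is trivial exactly when there is no simple reflection, a case
    that the theorem includes. *)
Lemma trivial_Irr_unique (lam : Irr R W) : #|W| = 1%N -> lam = [1 Irr R W]%irr.
Proof.
move=> W1; apply/eqP; apply: contraT => ne1; have := sum_sqr_dimW.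
rewrite W1 (bigD1 lam) //= (bigD1 [1 Irr R W]%irr) /=; last by rewrite eq_sym.
rewrite dimW_triv exp1n addnCA => -[] /eqP.
by rewrite add0n addn_eq0 expn_eq0 gtn_eqF // dimW_gt0.
Qed.

Section Deformation.
Variables (H : forall q : R, hecke_algebra S q) (n : R -> Irr R W -> nat).
Variable rho : forall (q : R) (lam : Irr R W), H q -> 'M[R[i]]_(n q lam).
Hypothesis Hrho : hecke_deformation rho.
Variable lam : Irr R W.
Local Notation T r := (hecke_T (H r)).

Lemma deformation_irreducible q : 0 < q -> alg_irreducible (@rho q lam).
Proof. by move=> q0; apply: (indexes_irr (deformation_irr Hrho q0)). Qed.

Lemma deformation_repr q : 0 < q -> alg_repr (@rho q lam).
Proof. by case/deformation_irreducible. Qed.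

Lemma deformation_trace1 q : 0 < q -> \tr (rho lam (T q 1%g)) = (n q lam)%:R.
Proof.
move=> q0; rewrite (heckeT1 HS (H q) _ s0S) ?gt_eqF //.
by rewrite (alg_repr1 (deformation_repr q0)) mxtrace1.
Qed.

(** The dimension is the value of the character at [T_1 = 1], a continuous
    function with values in the natural numbers. *)
Lemma deformation_dim q : 0 < q -> n q lam = dimW lam.
Proof.
move=> q0.
have := continuous_countable_const (f := fun r => \tr (rho lam (T r 1%g)))
  (v := fun k => k%:R) (fun r r0 => deformation_cont Hrho r0) _ q0 ltr01.
rewrite (deformation_at1 Hrho) charW1 deformation_trace1 // => E.
apply/eqP; rewrite -(eqr_nat R[i]) E // => r r0.
by exists (n r lam); rewrite deformation_trace1.
Qed.

Lemma deformation_trace_simple_cont s r : 0 < r ->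
  {for r, continuous ((fun r => (\tr (rho lam (T r s)) + (dimW lam)%:R) / (r%:C + 1))
     : R -> R[i]^o)}.
Proof.
move=> r0; apply: continuousM.
  by apply: continuousD; [exact: (deformation_cont Hrho)|exact: cst_continuous].
apply: continuousV; first exact: paramC_add1_neq0.
by apply: continuousD; [exact: real_complex_continuous|exact: cst_continuous].
Qed.

(** The multiplicity m of the eigenvalue q of [T_s] is
    (chi(T_s) + d) / (q + 1), again continuous with natural values; at q = 1 it
    is the multiplicity in the representation of [W]. *)
Lemma deformation_plus_mult s q : s \in S -> 0 < q ->
  \rank (rho lam (T q s) + 1%:M)%R = plus_mult lam s.
Proof.
move=> sS q0.
have val r : 0 < r -> (\tr (rho lam (T r s)) + (dimW lam)%:R) / (r%:C + 1)
    = (\rank (rho lam (T r s) + 1%:M)%R)%:R.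
  move=> r0; rewrite (trace_heckeT r0 (deformation_irreducible r0)) //.
  by rewrite -(deformation_dim r0) subrK mulrAC divff ?mul1r // paramC_add1_neq0.
have := continuous_countable_const (v := fun k => k%:R)
  (fun r => deformation_trace_simple_cont (s := s) (r := r)) _ q0 ltr01.
rewrite val // (deformation_at1 Hrho) charW_reflection; last first.
  by rewrite mem_class_support.
rewrite subrK rmorph1 mulrAC divff ?mul1r ?pnatr_eq0 // => E.
apply/eqP; rewrite -(eqr_nat R[i]) E // => r r0.
by exists (\rank (rho lam (T r s) + 1%:M)%R); rewrite val.
Qed.

(** The structure constants of the algebra are polynomials in q, so the
    continuity of characters on the basis extends to products. *)
Lemma deformation_trace_mul_cont x y q : 0 < q ->
  {for q, continuous ((fun r => \tr (rho lam (T r x * T r y))) : R -> R[i]^o)}.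
Proof.
elim/(coxeter_length_ind_r HS): x y q => [|s x sS len_xs IH] y q q0.
  apply: eq_pos_continuous_at q0 (deformation_cont Hrho q0) => r r0.
  by rewrite (heckeT1 HS (H r) _ s0S) ?gt_eqF // mul1r.
have E r : 0 < r -> T r (x * s)%g * T r y = T r x * (T r s * T r y).
  by move=> r0; rewrite (heckeT_mulS HS (H r) _ s0S) ?gt_eqF // mulrA.
have [up|down] := coxeter_length_simpleM HS y sS.
  apply: eq_pos_continuous_at q0 (IH (s * y)%g q q0) => r r0.
  by rewrite E // (hecke_mul_up (H r) sS up).
pose g (r : R) := (r%:C - 1) * \tr (rho lam (T r x * T r y))
   + r%:C * \tr (rho lam (T r x * T r (s * y)%g)).
apply: (@eq_pos_continuous_at _ _ g _ q q0) => [r r0|].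
  rewrite E // (hecke_mul_down (H r) sS down) mulrDr -!scalerAr.
  have rp := deformation_repr r0.
  by rewrite (alg_reprD rp) !(alg_reprZ rp) raddfD /= !mxtraceZ rmorphB rmorph1.
apply: continuousD; apply: continuousM; try exact: IH; last exact: real_complex_continuous.
by apply: continuousB; [exact: real_complex_continuous|exact: cst_continuous].
Qed.

(** The scalar z of [T_w0 ^+ 2] satisfies z^d = det, and the determinant is
    known from the multiplicities.  The root of unity by which z differs from
    the positive root is a continuous function of q, hence constant, and it is
    1 at q = 1 because [w0 ^+ 2 = 1]. *)
Lemma deformation_scalar q w0 : 0 < q -> is_longest S w0 ->
  rho lam (T q w0 ^+ 2) = ((q `^ ((len w0)%:R + refl_content S lam))%:C)%:M.
Proof.
move=> q0 Hw0; set c := _ + _.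
have dC0 : (dimW lam)%:R != 0 :> R[i] by rewrite pnatr_eq0 -lt0n dimW_gt0.
(* f is the root of unity by which the scalar differs from r `^ c. *)
pose f r := \tr (rho lam (T r w0 * T r w0)) / ((dimW lam)%:R * (r `^ c)%:C).
have powC0 r : 0 < r -> (r `^ c)%:C != 0 :> R[i].
  by move=> r0; rewrite paramC_neq0 // gt_eqF // powR_gt0.
have f_scalar r : 0 < r -> rho lam (T r w0 ^+ 2) = (f r * (r `^ c)%:C)%:M.
  move=> r0; have [z Ez] := heckeT_longest_sqr_scalar r0 (deformation_irreducible r0) Hw0.
  rewrite Ez /f -expr2 Ez mxtrace_scalar deformation_dim // -[z *+ _]mulr_natr.
  by rewrite invfM mulrA mulfK // divfK // powC0.
have f_root r : 0 < r -> f r ^+ dimW lam = 1.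
  move=> r0; have rp := deformation_repr r0.
  have := det_heckeT_longest r0 (deformation_irreducible r0) Hw0
    (plus_multJ lam) (fun s sS => deformation_plus_mult sS r0).
  rewrite expr2 -det_mulmx -(alg_reprM rp) -expr2 f_scalar // det_scalar deformation_dim //.
  rewrite exprMn -rmorphXn -powR_mulrn ?powR_ge0 // -powRrM /c.
  have -> : ((len w0)%:R + refl_content S lam) * (dimW lam)%:R
      = (2 * \sum_(t in reflections S) plus_mult lam t)%:R.
    by rewrite sum_plus_mult -(coxeter_length_longest HS Hw0) mulrC.
  rewrite powR_mulrn ?ltW // rmorphXn -[RHS]mul1r => fE; apply: (mulIf _ fE).
  by rewrite expf_neq0 // (paramC_neq0 (q := r)) // gt_eqF.
have [rs rsP] : exists rs : seq R[i], forall z, z ^+ dimW lam = 1 -> z \in rs.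
  have [rs Ers] := closed_field_poly_normal ('X^(dimW lam) - 1 : {poly R[i]}).
  exists rs => z z1; rewrite -root_prod_XsubC.
  rewrite -(rootZ _ _ (a := lead_coef ('X^(dimW lam) - 1))) -?Ers.
    by rewrite rootE !hornerE z1 subrr.
  by rewrite (monicP (monicXnsubC _ (dimW_gt0 lam))) oner_eq0.
have f_cont r : 0 < r -> {for r, continuous (f : R -> R[i]^o)}.
  move=> r0; apply: continuousM; first exact: deformation_trace_mul_cont.
  apply: continuousV; first by rewrite mulf_neq0 ?powC0.
  by apply: continuousM; [exact: cst_continuous|exact: powRC_continuous_at].
have f1 : f 1 = 1.
  rewrite /f (heckeT_mul1 HS (H 1) _ s0S) ?oner_eq0 // (longest_sqr HS Hw0).
  by rewrite (deformation_at1 Hrho) charW1 powR1 mulr1 divff.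
rewrite f_scalar // (continuous_countable_const (v := fun k => nth 0 rs k) f_cont _ q0 ltr01).
  by rewrite f1 mul1r.
by move=> r r0; exists (index (f r) rs); rewrite nth_index // rsP // f_root.
Qed.

End Deformation.
End HeckeRepr.

(** * Reversible chains and the Hecke algebra *)

Section Markov.
Variables (R : realType) (W : finType) (K : W -> W -> R).

Lemma kernel_powD a b x y :
  kernel_pow K (a + b) x y = \sum_z kernel_pow K a x z * kernel_pow K b z y.
Proof.
elim: a x => [|a IH] x /=.
  rewrite (bigD1 x) //= eqxx mul1r big1 ?addr0 // => z /negPf ne_zx.
  by rewrite eq_sym ne_zx mul0r.
under eq_bigr do rewrite IH mulr_sumr.
rewrite exchange_big /=; apply: eq_bigr => z _.
by rewrite mulr_suml; apply: eq_bigr => u _; rewrite mulrA.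
Qed.

Hypothesis HK : markov_chain K.

Lemma kernel_pow_row_sum l x : \sum_y kernel_pow K l x y = 1.
Proof.
elim: l x => [|l IH] x /=.
  by rewrite (bigD1 x) //= eqxx big1 ?addr0 // => y /negPf ne_yx; rewrite eq_sym ne_yx.
rewrite exchange_big /= -[RHS](HK.2 x); apply: eq_bigr => z _.
by rewrite -mulr_sumr IH mulr1.
Qed.

Variable p : W -> R.
Hypotheses (p_gt0 : forall x, 0 < p x) (p_sum : \sum_x p x = 1) (HKrev : reversible p K).

Lemma kernel_pow_reversible l : reversible p (kernel_pow K l).
Proof.
elim: l => [|l IH] x y /=.
  by case: (eqVneq x y) => [->//|_]; rewrite !mulr0.
have -> : \sum_z K y z * kernel_pow K l z x = \sum_z kernel_pow K l y z * K z x.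
  have := kernel_powD l 1 y x; rewrite addn1 /= => ->; apply: eq_bigr => z _.
  congr (_ * _); rewrite (bigD1 x) //= eqxx mulr1 big1 ?addr0 // => u /negPf ->.
  by rewrite mulr0.
rewrite !mulr_sumr; apply: eq_bigr => z _.
by rewrite mulrA HKrev mulrAC IH -mulrA.
Qed.

(** Reversibility turns the sum of K^l(x,y)^2 / p(y) into a sum over closed
    paths: the chi-square distance is a return probability. *)
Lemma norm2_sq_kernel_pow l x :
  norm2_sq p (fun y => kernel_pow K l x y / p y - 1)
    = kernel_pow K (l + l) x x / p x - 1.
Proof.
have p0 y : p y != 0 by rewrite gt_eqF.
rewrite /norm2_sq kernel_powD mulr_suml.
transitivity (\sum_y (kernel_pow K l x y * kernel_pow K l y x / p x
    - kernel_pow K l x y *+ 2 + p y)).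
  apply: eq_bigr => y _; rewrite -mulrA.
  have -> : kernel_pow K l y x / p x = kernel_pow K l x y / p y.
    apply: (mulIf (p0 x)); apply: (mulIf (p0 y)).
    by rewrite mulrVK ?unitfE // mulrAC mulrVK ?unitfE // mulrC -kernel_pow_reversible mulrC.
  by field.
by rewrite !big_split /= sumrN sumrMnl kernel_pow_row_sum p_sum -addrA mulr2n opprD subrK.
Qed.

End Markov.

Section Main.
Variables (R : realType) (W : finGroupType) (S : {set W}).
Hypothesis HS : coxeter_system S.
Local Notation len := (coxeter_length S).

Section Pi.
Variables (q : R) (q0 : 0 < q).

Lemma poincare_gt0 : 0 < poincare S q.
Proof.
rewrite /poincare (bigD1 1%g) //= ltr_pwDl ?exprn_gt0 // sumr_ge0 // => w _.
by rewrite exprn_ge0 // ltW.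
Qed.

Lemma pi_dist_gt0 w : 0 < pi_dist S q w.
Proof. by rewrite divr_gt0 ?exprn_gt0 // poincare_gt0. Qed.

Lemma pi_dist_sum : \sum_w pi_dist S q w = 1.
Proof. by rewrite -mulr_suml divff // gt_eqF // poincare_gt0. Qed.

Lemma determined_by_pow (H : hecke_algebra S q) (K : W -> W -> R) (h : H) l :
  determined_by K h -> determined_by (kernel_pow K l) (h ^+ l).
Proof.
move=> hK; elim: l => [|l IH] x /=.
  rewrite expr0 mul1r (bigD1 x) //= eqxx scale1r big1 ?addr0 // => y /negPf ne_yx.
  by rewrite eq_sym ne_yx scale0r.
rewrite exprSr -mulrA hK mulr_sumr.
have hT z : h ^+ l * ((K x z)%:C *: hecke_Tt H z)
    = \sum_y (K x z * kernel_pow K l z y)%:C *: hecke_Tt H y.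
  rewrite -scalerAr IH scaler_sumr; apply: eq_bigr => y _.
  by rewrite scalerA -rmorphM.
rewrite (eq_bigr _ (fun z _ => hT z)) exchange_big /=; apply: eq_bigr => y _.
by rewrite rmorph_sum scaler_suml.
Qed.

End Pi.

Section Trace.
Variables (q : R) (q0 : 0 < q) (H : hecke_algebra S q) (s0 : W) (s0S : s0 \in S).
Local Notation T := (hecke_T H).
Local Notation Tt := (hecke_Tt H).
Let qn0 : q != 0. Proof. by rewrite gt_eqF. Qed.

Lemma return_hecke_trace (K : W -> W -> R) (h : H) : determined_by K h ->
  hecke_trace h = (K 1%g 1%g / pi_dist S q 1%g)%:C.
Proof.
move=> /(_ 1%g); rewrite {1}/hecke_Tt coxeter_length1 expr0 invr1 scale1r.
rewrite (heckeT1 HS H qn0 s0S) mulr1 => ->.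
rewrite /hecke_trace -/(hecke_coef (H := H) 1%g) linear_sum /= (bigD1 1%g) //= big1 ?addr0.
  rewrite /hecke_Tt !linearZ /= hecke_coefT eqxx /pi_dist coxeter_length1 expr0 invr1 mulr1.
  by rewrite rmorph1 mulr1 -rmorphM /= div1r invrK mulrC.
by move=> y ne_y1; rewrite /hecke_Tt !linearZ /= hecke_coefT eq_sym (negPf ne_y1) !mulr0.
Qed.

(** Up to normalization, the primitive idempotent of the index representation
    [T_w |-> q^len w], whose linear extension is [index_char]. *)
Definition hecke_sum : H := \sum_w T w.
Definition index_char (a : H) : R[i] := \sum_w hecke_coef w a * q%:C ^+ len w.

(** The relation holds for [T_w + T_(s w)] whichever of the two is longer;
    summing over all [w] counts each such pair twice, whence the factor 2. *)
Lemma heckeT_simple_sum s : s \in S -> T s * hecke_sum = q%:C *: hecke_sum.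
Proof.
move=> sS; have two0 : 2%:R != 0 :> R[i] by rewrite pnatr_eq0.
(* Twice hecke_sum is the sum of all T_(s w) + T_w. *)
apply: (scalerI two0); rewrite !scaler_nat !mulr2n.
have sum_s : hecke_sum = \sum_w T (s * w)%g by rewrite /hecke_sum (reindex_inj (mulgI s)).
rewrite -mulrDr -scalerDr {1 3}sum_s /hecke_sum -big_split /= mulr_sumr scaler_sumr.
apply: eq_bigr => w _.
have pair v : len (s * v) = (len v).+1 -> T s * (T (s * v)%g + T v) = q%:C *: (T (s * v)%g + T v).
  move=> up; rewrite mulrDr (hecke_mul_up H sS up) hecke_mul_down // mulgA
    (simple_sqr HS sS) mul1g //.
  by rewrite rmorphB rmorph1 scalerBl scale1r scalerDr addrAC subrK.
have [up|down] := coxeter_length_simpleM HS w sS; first exact: pair.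
have ssw : (s * (s * w) = w)%g by rewrite mulgA (simple_sqr HS sS) mul1g.
by have := pair (s * w)%g; rewrite ssw addrC => ->.
Qed.

Lemma index_charE a : a * hecke_sum = index_char a *: hecke_sum.
Proof.
rewrite {1}(hecke_expand a) mulr_suml scaler_suml; apply: eq_bigr => w _.
rewrite -scalerAl -scalerA; congr (_ *: _).
elim/(coxeter_length_ind (coxeter_gen HS)): w => [|s w sS len_sw IH].
  by rewrite (heckeT1 HS H qn0 s0S) coxeter_length1 mul1r scale1r.
rewrite -(hecke_mul_up H sS len_sw) -mulrA IH -scalerAr heckeT_simple_sum //.
by rewrite scalerA len_sw exprSr.
Qed.

End Trace.

End Main.

(** * Decomposition of the Hecke algebra *)

Section IndexRepr.
Variables (R : realType) (W : finGroupType) (S : {set W}).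
Hypothesis HS : coxeter_system S.
Variables (s0 : W) (s0S : s0 \in S).
Variables (q : R) (q0 : 0 < q) (H : hecke_algebra S q).
Local Notation e := (hecke_sum H).

(** [rho a *m rho e] is a multiple of [rho e], so the left kernel of [rho e] is
    a subrepresentation.  If it is everything, then [rho e = 0]; if it is zero,
    then [rho e] is invertible and all the [rho a] are scalars. *)
Lemma repr_hecke_sum_eq0 n (rho : H -> 'M[R[i]]_n) : alg_irreducible rho ->
  rho e = 0 \/ (n = 1%N /\ forall a, rho a = (index_char a)%:M).
Proof.
move=> [repr n_gt0 irrU].
have actE a : rho a *m rho e = index_char a *: rho e.
  by rewrite -(alg_reprM repr) (index_charE HS q0 s0S) (alg_reprZ repr).
have [ker0|ker_n0] := eqVneq (kermx (rho e)) 0; last first.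
  left; have /row_fullP[B BK] : row_full (kermx (rho e)).
    apply: irrU ker_n0 => a; apply/sub_kermxP.
    by rewrite -mulmxA actE -scalemxAr mulmx_ker scaler0.
  by rewrite -[rho e]mul1mx -BK -mulmxA mulmx_ker mulmx0.
right; have e_free : row_free (rho e) by rewrite -kermx_eq0 ker0.
have scal a : rho a = (index_char a)%:M.
  by apply: (row_free_inj e_free); rewrite /= actE mul_scalar_mx.
split=> //; pose i0 := Ordinal n_gt0.
have : row_full (delta_mx i0 i0 : 'M[R[i]]_n).
  apply: irrU => [a|]; first by rewrite scal mul_mx_scalar scalemx_sub.
  by rewrite -mxrank_eq0 mxrank_delta.
by rewrite /row_full mxrank_delta => /eqP.
Qed.

End IndexRepr.

Section Deformed.
Variables (R : realType) (W : finGroupType) (S : {set W}).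
Hypothesis HS : coxeter_system S.
Local Notation len := (coxeter_length S).
Variables (s0 : W) (s0S : s0 \in S).
Variables (H : forall q : R, hecke_algebra S q) (n : R -> Irr R W -> nat).
Variable rho : forall (q : R) (lam : Irr R W), H q -> 'M[R[i]]_(n q lam).
Hypothesis Hrho : hecke_deformation rho.
Variables (q : R) (q0 : 0 < q) (t : Irr R W -> R[i]).
Hypothesis Ht : generic_degrees (@rho q) t.
Local Notation T := (hecke_T (H q)).
Local Notation Tt := (hecke_Tt (H q)).
Local Notation e := (hecke_sum (H q)).
Local Notation triv := [1 Irr R W]%irr.
Let qn0 : q != 0. Proof. by rewrite gt_eqF. Qed.

Lemma plus_mult_triv x : plus_mult triv x = 1%N.
Proof.
rewrite /plus_mult irr1_repr ?in_group_setT // -raddfD /= -(scalemx1 _ (1 + 1)).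
by rewrite mxrank_scale_nz ?mxrank1 ?degree_irr1 // (pnatr_eq0 _ 2).
Qed.

Lemma refl_content_triv : refl_content S triv = #|reflections S|%:R.
Proof.
have := sum_plus_mult HS triv; rewrite dimW_triv mul1r.
under eq_bigr do rewrite plus_mult_triv.
by rewrite sum1_card natrM mulr_natl mulr2n => /addrI->.
Qed.

(** All multiplicities of the trivial representation of [W] are full, so [T_s]
    acts by q. *)
Lemma deformation_triv (a : H q) : rho triv a = (index_char a)%:M.
Proof.
have irr := deformation_irreducible Hrho triv q0.
have repr := deformation_repr Hrho triv q0.
have n1 : n q triv = 1%N by rewrite (deformation_dim HS s0S Hrho triv q0) dimW_triv.
have rhoS s : s \in S -> rho triv (T s) = (q%:C)%:M.
  move=> sS; apply/eqP; rewrite -subr_eq0; apply/eqP.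
  have full : row_free (rho triv (T s) + 1%:M)%R.
    by rewrite /row_free (deformation_plus_mult HS s0S Hrho triv sS q0) plus_mult_triv n1.
  (* rho (T s) + 1 is invertible, so the quadratic relation can be divided by it. *)
  apply: (row_free_inj full); rewrite /= mul0mx.
  exact: (repr_heckeT_quadratic HS s0S q0 irr).
rewrite {1}(hecke_expand a) (alg_repr_sum repr) raddf_sum /=; apply: eq_bigr => w _.
rewrite (alg_reprZ repr) -scale_scalar_mx; congr (_ *: _).
elim/(coxeter_length_ind (coxeter_gen HS)): w => [|s w sS len_sw IH].
  by rewrite (heckeT1 HS (H q) qn0 s0S) coxeter_length1 (alg_repr1 repr).
by rewrite -(hecke_mul_up (H q) sS len_sw) (alg_reprM repr) IH rhoS // len_sw -scalar_mxM exprS.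
Qed.

Lemma deformation_hecke_sum lam : lam != triv -> rho lam e = 0.
Proof.
move=> ne1; have irr := deformation_irreducible Hrho lam q0.
have [//|[n1 scal]] := repr_hecke_sum_eq0 HS s0S q0 irr.
case/eqP: ne1; apply: (indexes_inj (deformation_irr Hrho q0)).
have n1' : n q triv = 1%N by rewrite (deformation_dim HS s0S Hrho triv q0) dimW_triv.
exists (pid_mx (n q lam)); split.
- by rewrite n1 n1'.
- by rewrite /row_free rank_pid_mx // n1 n1'.
by move=> a; rewrite scal deformation_triv mul_scalar_mx mul_mx_scalar.
Qed.

Lemma poincareC_neq0 : (poincare S q)%:C != 0 :> R[i].
Proof. by rewrite paramC_neq0 // gt_eqF // poincare_gt0. Qed.

(** Evaluate the trace at [hecke_sum], on which only the index character does
    not vanish. *)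
Lemma generic_degree_triv : t triv = 1.
Proof.
have := Ht e; rewrite (bigD1 triv) //= big1 ?addr0 => [|lam /deformation_hecke_sum->]; last first.
  by rewrite mxtrace0 mulr0.
have coef_e w : hecke_coef w e = 1.
  rewrite linear_sum (bigD1 w) //= hecke_coefT eqxx big1 ?addr0 // => v /negPf ne_vw.
  by rewrite hecke_coefT eq_sym ne_vw.
rewrite /hecke_trace -/(hecke_coef (H := H q) 1%g) coef_e mulr1 deformation_triv.
rewrite mxtrace_scalar (deformation_dim HS s0S Hrho triv q0) dimW_triv mulr1n.
have -> : index_char e = (poincare S q)%:C.
  rewrite /index_char /poincare rmorph_sum; apply: eq_bigr => w _.
  by rewrite coef_e mul1r rmorphXn.
by move=> E; apply: (mulIf poincareC_neq0); rewrite mul1r -E.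
Qed.

(** An element killed by every representation is in the radical of the trace
    form, because the trace is a combination of the characters. *)
Lemma hecke_repr_faithful (a : H q) : (forall lam, rho lam a = 0) -> a = 0.
Proof.
move=> rho0; apply: (hecke_trace_nondegenerate HS qn0 s0S) => b.
apply: (mulfI poincareC_neq0); rewrite mulr0 -/(hecke_trace _) Ht big1 // => lam _.
by rewrite (alg_reprM (deformation_repr Hrho lam q0)) rho0 mulmx0 mxtrace0 mulr0.
Qed.

Local Notation entry := {lam : Irr R W & ('I_(n q lam) * 'I_(n q lam))%type}.

Lemma card_entry : #|{: entry}| = #|W|.
Proof.
rewrite card_tagged sumnE big_map big_enum /=.
rewrite (eq_bigr (fun lam => (dimW lam ^ 2)%N)) => [|lam _]; last first.
  by rewrite card_prod card_ord (deformation_dim HS s0S Hrho lam q0) mulnn.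
exact: sum_sqr_dimW.
Qed.

(** The matrix entries of all the representations embed H into a product of
    matrix algebras.  Both sides have dimension #|W|, so the embedding is an
    isomorphism; it conjugates left multiplication by h, whose matrix is K, to
    a diagonal map in which the scalar of lam occurs d^2 times. *)
Lemma mxtrace_left_mul (K : W -> W -> R) (h : H q) (z : Irr R W -> R[i]) :
  determined_by K h -> (forall lam, rho lam h = (z lam)%:M) ->
  (\sum_x K x x)%:C = \sum_lam (dimW lam)%:R ^+ 2 * z lam.
Proof.
move=> hK hz.
pose Phi := \matrix_(i < #|W|, j < #|{: entry}|)
  let u := enum_val j in rho (tag u) (Tt (enum_val i)) (tagged u).1 (tagged u).2.
pose D : 'M[R[i]]_#|{: entry}| := diag_mx (\row_j z (tag (enum_val j))).
pose KM := \matrix_(i < #|W|, j < #|W|) (K (enum_val i) (enum_val j))%:C.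
have Phi_free : row_free Phi.
  rewrite -kermx_eq0; apply/rowV0P => v /sub_kermxP vPhi.
  pose a := \sum_i v 0 i *: Tt (enum_val i).
  have a0 : a = 0.
    apply: hecke_repr_faithful => lam; apply/matrixP => i j.
    have repr := deformation_repr Hrho lam q0.
    rewrite (alg_repr_sum repr) summxE mxE.
    pose u : entry := Tagged (fun lam => ('I_(n q lam) * 'I_(n q lam))%type) (i, j).
    move/rowP: vPhi => /(_ (enum_rank u)).
    rewrite !mxE => E; rewrite -[RHS]E; apply: eq_bigr => k _.
    by rewrite (alg_reprZ repr) !mxE enum_rankK.
  apply/rowP => i; rewrite mxE.
  have := congr1 (hecke_coef (enum_val i)) a0; rewrite linear0 linear_sum (bigD1 i) //=.
  rewrite big1 ?addr0 => [|j ne_ji]; last first.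
    by rewrite /hecke_Tt !linearZ /= hecke_coefT (inj_eq enum_val_inj) eq_sym (negPf ne_ji) !mulr0.
  rewrite /hecke_Tt !linearZ /= hecke_coefT eqxx mulr1 => /eqP.
  by rewrite mulf_eq0 (negPf (paramC_neq0 _)) ?orbF ?invr_neq0 ?expf_neq0 // => /eqP.
have inter : KM *m Phi = Phi *m D.
  apply/matrixP => i j; rewrite mul_mx_diag !mxE; set u := enum_val j.
  have repr := deformation_repr Hrho (tag u) q0.
  transitivity (rho (tag u) (h * Tt (enum_val i)) (tagged u).1 (tagged u).2).
    rewrite hK (alg_repr_sum repr) summxE.
    rewrite (reindex (@enum_val W W)) /=; last first.
      by apply: onW_bij; apply: enum_val_bij.
    by apply: eq_bigr => k _; rewrite !mxE (alg_reprZ repr) mxE.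
  by rewrite (alg_reprM repr) hz mul_scalar_mx mxE mulrC.
have trE := mxtrace_intertwine Phi_free (esym card_entry) inter.
transitivity (\tr KM).
  rewrite rmorph_sum /mxtrace (reindex (@enum_val W W)) /=; last first.
    by apply: onW_bij; apply: enum_val_bij.
  by apply: eq_bigr => k _; rewrite mxE.
rewrite trE mxtrace_diag.
under eq_bigr do rewrite mxE.
rewrite (reindex enum_rank) /=; last by apply: onW_bij; apply: enum_rank_bij.
under eq_bigr do rewrite enum_rankK.
have -> : \sum_(u : entry) z (tag u) = \sum_lam \sum_(p : 'I_(n q lam) * 'I_(n q lam)) z lam.
  by rewrite sig_big_dep.
apply: eq_bigr => lam _.
rewrite sumr_const card_prod card_ord (deformation_dim HS s0S Hrho lam q0).
by rewrite -[LHS]mulr_natl natrM expr2.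
Qed.

End Deformed.

(** * The systematic scan *)

Section Scan.
Variables (R : realType) (W : finGroupType) (S : {set W}).
Hypothesis HS : coxeter_system S.
Local Notation len := (coxeter_length S).

Variables (s0 : W) (s0S : s0 \in S).
Variables (H : forall q : R, hecke_algebra S q) (n : R -> Irr R W -> nat).
Variable rho : forall (q : R) (lam : Irr R W), H q -> 'M[R[i]]_(n q lam).
Hypothesis Hrho : hecke_deformation rho.

(** The factors q^(- 2 len w0) from the normalization of [hecke_Tt] turn the
    exponent len w0 + c into c - len w0, and theta is the inverse of q. *)
Lemma scan_scalar (theta q : R) (w0 : W) (lam : Irr R W) (k : nat) :
  0 < theta -> q = theta^-1 -> is_longest S w0 ->
  rho lam ((hecke_Tt (H q) w0 ^+ 2) ^+ k)
    = (theta `^ (k%:R * ((len w0)%:R - refl_content S lam)))%:C%:M.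
Proof.
move=> th0 Hq Hw0; have q0 : 0 < q by rewrite Hq invr_gt0.
have repr := deformation_repr Hrho lam q0.
have -> : theta `^ (k%:R * ((len w0)%:R - refl_content S lam))
    = (q ^- len w0 ^+ 2 * q `^ ((len w0)%:R + refl_content S lam)) ^+ k.
  have -> : theta = q `^ (- 1) by rewrite powR_inv1 ?Hq ?invrK // invr_ge0 ltW.
  rewrite -powR_invn ?ltW // -!powR_mulrn ?mulr_ge0 ?powR_ge0 // -?powRrM.
  rewrite -powRD; last by rewrite (gt_eqF q0) ?implybT.
  rewrite -powRrM; congr (_ `^ _).
  by ring.
rewrite rmorphXn; apply: (alg_repr_scalarX repr).
rewrite /hecke_Tt exprZn (alg_reprZ repr) (deformation_scalar HS s0S Hrho lam q0 Hw0).
by rewrite scale_scalar_mx -rmorphXn -rmorphM.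
Qed.

End Scan.

Theorem theorem4p10 (R : realType) (W : finGroupType) (S : {set W})
    (HS : coxeter_system S)
    (H : forall q : R, hecke_algebra S q)
    (n : R -> Irr R W -> nat)
    (rho : forall (q : R) (lam : Irr R W), H q -> 'M[R[i]]_(n q lam))
    (Hrho : hecke_deformation rho)
    (theta : R) (Htheta : 0 < theta <= 1) (q : R) (Hq : q = theta^-1)
    (t : Irr R W -> R[i]) (Ht : generic_degrees (rho q) t)
    (w0 : W) (Hw0 : is_longest S w0)
    (K : W -> W -> R) (HK : markov_chain K) (HKrev : reversible (pi_dist S q) K)
    (HKdet : determined_by K (hecke_Tt (H q) w0 ^+ 2))
    (l : nat) :
  (norm2_sq (pi_dist S q)
      (fun y => kernel_pow K l 1%g y / pi_dist S q y - 1))%:C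
    = \sum_(lam : Irr R W | lam != [1 Irr R W]%irr)
        t lam * (dimW lam)%:R
        * (theta `^ (2 * l%:R * ((coxeter_length S w0)%:R - refl_content S lam)))%:C
  /\
  \sum_(x : W) pi_dist S q x
      * norm2_sq (pi_dist S q)
          (fun y => kernel_pow K l x y / pi_dist S q y - 1)
    = \sum_(lam : Irr R W | lam != [1 Irr R W]%irr)
        (dimW lam)%:R ^+ 2
        * theta `^ (2 * l%:R * ((coxeter_length S w0)%:R - refl_content S lam)).
Proof.
have th0 : 0 < theta by case/andP: Htheta.
have q0 : 0 < q by rewrite Hq invr_gt0.
have pi0 := pi_dist_gt0 S q0.
have norm x := norm2_sq_kernel_pow HK pi0 (pi_dist_sum S q0) HKrev l x.
have -> : \sum_(x : W) pi_dist S q x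
      * norm2_sq (pi_dist S q) (fun y => kernel_pow K l x y / pi_dist S q y - 1)
    = \sum_x kernel_pow K (l + l) x x - 1.
  rewrite -[X in _ = _ - X](pi_dist_sum S q0) -sumrB; apply: eq_bigr => x _.
  by rewrite norm mulrBr mulr1 mulrC divfK // gt_eqF.
rewrite norm.
(* Without simple reflections W is trivial, T_1 may differ from 1, and both
   sides of the two equations are 0. *)
have [S0|[s0 s0S]] := finset.set_0Vmem S.
  have W1 : #|W| = 1%N.
    by rewrite -cardsT -(coxeter_gen HS) S0 gen0 cards1.
  have all1 (x : W) : x = 1%g.
    have : x \in <<S>>%g by rewrite (coxeter_gen HS) inE.
    by rewrite S0 gen0 => /set1P.
  have sum1 (f : W -> R) : \sum_x f x = f 1%g.
    by rewrite (bigD1 1%g) //= big1 ?addr0 // => x; rewrite (all1 x) eqxx.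
  have := kernel_pow_row_sum HK (l + l) 1%g; have := pi_dist_sum S q0.
  rewrite !sum1 => -> ->; rewrite divr1 subrr.
  by rewrite !big1 // => lam; rewrite (trivial_Irr_unique lam W1) eqxx.
have -> : 2 * l%:R = (l + l)%:R :> R by rewrite natrD mulr_natl mulr2n.
have Kdet := determined_by_pow (l + l) HKdet.
have scal lam := scan_scalar HS s0S Hrho lam (l + l) th0 Hq Hw0.
have triv_exp : (coxeter_length S w0)%:R - refl_content S [1 Irr R W]%irr = 0 :> R.
  by rewrite refl_content_triv // (coxeter_length_longest HS Hw0) subrr.
split.
  transitivity (hecke_trace ((hecke_Tt (H q) w0 ^+ 2) ^+ (l + l)) - 1).
    by rewrite (return_hecke_trace HS q0 s0S Kdet) rmorphB rmorph1.
  rewrite Ht.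
  rewrite (bigD1 [1 Irr R W]%irr) //= scal triv_exp mulr0 powRr0.
  rewrite (generic_degree_triv HS s0S Hrho q0 Ht) mul1r mxtrace1.
  rewrite (deformation_dim HS s0S Hrho _ q0) dimW_triv addrC addrK.
  apply: eq_bigr => lam _; rewrite scal mxtrace_scalar.
  by rewrite (deformation_dim HS s0S Hrho lam q0) -[_ *+ _]mulr_natl mulrA.
apply: complexI.
transitivity ((\sum_x kernel_pow K (l + l) x x)%:C - 1 : R[i]).
  by rewrite rmorphB rmorph1.
rewrite (mxtrace_left_mul HS s0S Hrho q0 Ht Kdet scal).
rewrite (bigD1 [1 Irr R W]%irr) //= triv_exp mulr0 powRr0 dimW_triv expr1n mulr1.
rewrite addrC addrK rmorph_sum; apply: eq_bigr => lam _.
by rewrite rmorphM rmorphXn /= rmorph_nat.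
Qed.
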